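(* Let $d\ge 1$ and let $\Delta$ be a $(d-1)$-dimensional cubical complex with a shelling $F_1,\ldots,F_r$. For $1\le t\le r$ let $P_t$ be the face poset (including the empty face) of the subcomplex $\Delta_t=F_1\cup\cdots\cup F_t$, and let $f(P_t,x)$ be its toric $f$-polynomial (defined in the context, with $d$ the maximum chain length). For nonnegative integers $i,j$ put $$f_d(i,j,x):=\sum_{k=0}^{d-1} C_{d-1-k}\,(1-x)^k x^{d-k}\sum_{s=0}^{j}\binom{j}{s}\binom{d+i+j-1-k-s}{k-s}\qquad(\ast)$$ and $$f_d(0,d-1,x):=\sum_{k=0}^{d-1} C_{d-1-k}\binom{d-1-k}{k}(x-1)^k\qquad(\ast\ast),$$ where $C_n=\frac{1}{n+1}\binom{2n}{n}$. Then $f(P_1,x)$ equals the polynomial $(\ast)$ with $i=j=0$, and for every $t\ge 2$, if $F_t$ has type $(i,j)$, then $f(P_t,x)-f(P_{t-1},x)$ equals $(\ast)$ when $j\ne d-1$, and equals $(\ast\ast)$ when $(i,j)=(0,d-1)$.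
   Context: Toric polynomials (Stanley). For a finite poset $P$ with a minimum $\hat0$ such that $\hat P=P\cup\{\hat1\}$ ($\hat1$ a new maximum) is an Eulerian poset of rank $d+1$ (graded, and every open interval has equally many elements of odd and even rank), with rank function $\rho$, define recursively: $f(\emptyset,x)=g(\emptyset,x)=1$; if $d+1\ge1$, $f(P,x)=\sum_{t\in P} g([\hat0,t),x)(x-1)^{d-\rho(t)}$, and if $f(P,x)=\sum_i k_ix^i$ then $g(P,x)=\sum_{i=0}^{\lfloor d/2\rfloor}(k_i-k_{i-1})x^i$ with $k_{-1}=0$. A finite poset $P$ with minimum $\hat0$ is lower Eulerian if every interval $[\hat0,t]$ is Eulerian; then $f(P,x)=\sum_{t\in P} g([\hat0,t),x)(x-1)^{d-\rho(t)}$, where $\rho(t)$ is the length of a maximal chain in $[\hat0,t]$ and $d$ is the maximum length of a chain in $P$. The face poset of a polyhedral (in particular cubical) complex, ordered by inclusion and including the empty face, is lower Eulerian; for a $(d-1)$-dimensional complex its maximum chain length is $d$. Shelling and types. A shelling of a pure $(d-1)$-dimensional cubical complex is an ordering $F_1,\ldots,F_r$ of its facets such that for each $t\ge2$ the set $F_t\cap(F_1\cup\cdots\cup F_{t-1})$ is a union of $(d-2)$-dimensional faces of $F_t$ homeomorphic to a $(d-2)$-ball or $(d-2)$-sphere. For $t\ge 2$, $F_t$ has type $(i,j)$ if this intersection is the union of $j$ pairs of opposite $(d-2)$-faces of the cube $F_t$ together with $i$ further $(d-2)$-faces of $F_t$ whose opposite faces are not contained in the intersection; here $0\le i\le d-1$,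 and $i=0$ forces $j=d-1$. The first facet $F_1$ is regarded as having type $(0,0)$. *)

(* Defs.v *)
From HB Require Import structures.
From mathcomp Require Import all_boot all_order all_algebra finmap.
From mathcomp Require Import boolp classical_sets reals topology normedtype.

Set Implicit Arguments.
Unset Strict Implicit.
Unset Printing Implicit Defensive.

Import Order.TTheory GRing.Theory Num.Theory.
Import numFieldNormedType.Exports.

Local Open Scope classical_set_scope.
Local Open Scope ring_scope.

(** * Toric polynomials of finite posets *)

(* The maximal length (number of elements minus one) of a chain in P. *)
Definition height (disp : Order.disp_t) (T : porderType disp)
    (P : {fset T}) : nat :=
  (\max_(c <- fpowerset P | all2rel >=<%O (enum_fset c)) #|` c|.-1)%N.

(* The elements of P strictly below t, that is [0, t). *)
Definition below (disp : Order.disp_t) (T : porderType disp)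
    (P : {fset T}) (t : T) : {fset T} :=
  [fset s in P | (s < t)%O]%fset.

Definition prank (disp : Order.disp_t) (T : porderType disp)
    (P : {fset T}) (t : T) : nat :=
  height [fset s in P | (s <= t)%O]%fset.

(* From f = \sum_i k_i X^i to \sum_(i <= d/2) (k_i - k_(i-1)) X^i. *)
Definition toric_trunc (d : nat) (f : {poly int}) : {poly int} :=
  \poly_(i < (d./2).+1) (f`_i - (if i is i'.+1 then f`_i' else 0)).

(* The recursion of f and g is well founded on #|` P|; the first argument is
   fuel, and [toric_gE] below shows that #|` P| suffices. *)
Fixpoint toric_g_rec (disp : Order.disp_t) (T : porderType disp)
    (n : nat) (P : {fset T}) : {poly int} :=
  if n is n'.+1 then
    if P == fset0 then 1 else
      toric_trunc (height P)
        (\sum_(t <- P) toric_g_rec n' (below P t)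
                       * ('X - 1) ^+ (height P - prank P t))
  else 1.

(* When P with a new maximum adjoined is Eulerian of rank d + 1, d is the
   height of P; so one formula covers both the Eulerian and the lower
   Eulerian case. *)
Definition toric_g (disp : Order.disp_t) (T : porderType disp)
    (P : {fset T}) : {poly int} :=
  toric_g_rec #|` P| P.

Definition toric_f (disp : Order.disp_t) (T : porderType disp)
    (P : {fset T}) : {poly int} :=
  if P == fset0 then 1 else
    \sum_(t <- P) toric_g (below P t) * ('X - 1) ^+ (height P - prank P t).

Lemma card_below (disp : Order.disp_t) (T : porderType disp)
    (P : {fset T}) (t : T) : t \in P -> (#|` below P t| < #|` P|)%N.
Proof.
move=> tP; apply: fproper_ltn_card; rewrite fproperE; apply/andP; split.
  by apply/fsubsetP => s; rewrite !inE => /andP[].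
by apply/fsubsetPn; exists t => //; rewrite !inE ltxx andbF.
Qed.

Lemma toric_g_rec_fuel (disp : Order.disp_t) (T : porderType disp)
    (n : nat) (P : {fset T}) :
  (#|` P| <= n)%N -> toric_g_rec n P = toric_g P.
Proof.
rewrite /toric_g; have [m] := ubnP n.
elim: m n P => // m IH [|n] P ltnm lePn.
  by move: lePn; rewrite leqn0 => /eqP ->.
case: (eqVneq P fset0) => [->|P0]; first by rewrite cardfs0.
have Pgt0 : (0 < #|` P|)%N by rewrite cardfs_gt0.
case E : #|` P| Pgt0 => [//|k] _; rewrite /= (negPf P0).
congr toric_trunc; apply: eq_big_seq => t tP; congr (_ * _).
have := card_below tP; rewrite E ltnS => lek.
rewrite (IH n) //; last by apply: leq_trans lek _; rewrite -ltnS -E.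
by rewrite (IH k) //; apply: leq_ltn_trans (ltnm : (n < m)%N); rewrite -ltnS -E.
Qed.

Lemma toric_gE (disp : Order.disp_t) (T : porderType disp) (P : {fset T}) :
  toric_g P = if P == fset0 then 1 else toric_trunc (height P) (toric_f P).
Proof.
rewrite -(toric_g_rec_fuel (leqnSn _)) /= /toric_f.
case: ifP => // _; congr toric_trunc; apply: eq_big_seq => t tP.
by rewrite toric_g_rec_fuel // ltnW // card_below.
Qed.

(** * Polytopes and cubical complexes *)

Definition conv_hull (R : realType) (N : nat) (s : seq 'rV[R]_N) :
    set 'rV[R]_N :=
  [set x | exists w : 'I_(size s) -> R,
     [/\ forall i, 0 <= w i, \sum_i w i = 1 &
         x = \sum_i w i *: s`_i]].

Definition polytope (R : realType) (N : nat) (P : set 'rV[R]_N) : Prop :=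
  exists s : seq 'rV[R]_N, P = conv_hull s.

Definition dotv (R : realType) (N : nat) (c x : 'rV[R]_N) : R :=
  \sum_(i < N) c 0 i * x 0 i.

(* G is the part of P on which some valid inequality c.x <= b is an equality;
   c = 0 with b = 0 or b = 1 yields the faces P and set0. *)
Definition is_face (R : realType) (N : nat) (P G : set 'rV[R]_N) : Prop :=
  exists (c : 'rV[R]_N) (b : R),
    (forall x, P x -> dotv c x <= b) /\ G = P `&` [set x | dotv c x = b].

(* Affine dimension; the empty set (of dimension -1) satisfies has_dim for
   no k. *)
Definition has_dim (R : realType) (N : nat) (P : set 'rV[R]_N) (k : nat) :
    Prop :=
  exists (x0 : 'rV[R]_N) (B : 'M[R]_(k, N)),
    [/\ P x0, row_free B, forall i, P (x0 + row i B) &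
        forall x, P x -> (x - x0 <= B)%MS].

Definition std_cube (R : realType) (m : nat) : set 'rV[R]_m :=
  [set x | forall i, 0 <= x 0 i <= 1].

(* Isomorphism of face lattices; the equivalence makes phi injective on the
   faces of P. *)
Definition comb_equiv (R : realType) (M N : nat)
    (P : set 'rV[R]_M) (Q : set 'rV[R]_N) : Prop :=
  exists phi : set 'rV[R]_M -> set 'rV[R]_N,
    [/\ forall G, is_face P G -> is_face Q (phi G),
        forall H, is_face Q H -> exists2 G, is_face P G & phi G = H &
        forall G G', is_face P G -> is_face P G' ->
          (phi G `<=` phi G' <-> G `<=` G')].

Definition comb_cube (R : realType) (N m : nat) (P : set 'rV[R]_N) : Prop :=
  has_dim P m /\ comb_equiv P (@std_cube R m).

Definition polyhedral_complex (R : realType) (N : nat)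
    (K : {fset set 'rV[R]_N}) : Prop :=
  [/\ set0 \in K,
      forall P, P \in K -> polytope P,
      forall P G, P \in K -> is_face P G -> G \in K &
      forall P Q, P \in K -> Q \in K ->
        is_face P (P `&` Q) /\ is_face Q (P `&` Q)].

Definition cubical_complex (R : realType) (N : nat)
    (K : {fset set 'rV[R]_N}) : Prop :=
  polyhedral_complex K /\
  forall P, P \in K -> P !=set0 -> exists m, comb_cube m P.

Definition facet (R : realType) (N : nat) (K : {fset set 'rV[R]_N})
    (P : set 'rV[R]_N) : Prop :=
  P \in K /\ forall Q, Q \in K -> P `<=` Q -> Q = P.

(* As every complex contains set0 and set0 satisfies has_dim for no k, this
   excludes the complex whose only face is empty. *)
Definition pure_of_dim (R : realType) (N : nat) (K : {fset set 'rV[R]_N})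
    (k : nat) : Prop :=
  forall P, facet K P -> has_dim P k.

(** * Shellings *)

Definition homeomorphic (X Y : topologicalType) (A : set X) (B : set Y) :
    Prop :=
  exists (f : X -> Y) (g : Y -> X),
    [/\ forall x, A x -> B (f x) /\ g (f x) = x,
        forall y, B y -> A (g y) /\ f (g y) = y,
        {within A, continuous f} & {within B, continuous g}].

Definition unit_ball (R : realType) (n : nat) : set 'rV[R]_n :=
  [set x | dotv x x <= 1].

(* The sphere of dimension n - 1; it is empty for n = 0. *)
Definition unit_sphere (R : realType) (n : nat) : set 'rV[R]_n :=
  [set x | dotv x x = 1].

(* The (d-2)-dimensional faces of P. For d = 1 there is none: the empty face
   would contribute nothing to a union. *)
Definition ridge (R : realType) (N d : nat) (P G : set 'rV[R]_N) : Prop :=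
  is_face P G /\ exists2 k, k.+2 = d & has_dim G k.

(* In a (combinatorial) cube two facets are opposite when they are disjoint. *)
Definition opposite (R : realType) (N d : nat) (P G G' : set 'rV[R]_N) :
    Prop :=
  [/\ ridge d P G, ridge d P G' & G `&` G' = set0].

(* F_t `&` (F_1 `|` ... `|` F_(t-1)), where the 1-based F_t of the shelling
   order is the entry of index t - 1. *)
Definition attaching_set (R : realType) (N : nat) (F : seq (set 'rV[R]_N))
    (t : nat) : set 'rV[R]_N :=
  nth set0 F t.-1 `&` \bigcup_(G in [set` take t.-1 F]) G.

Definition shelling (R : realType) (N d : nat) (K : {fset set 'rV[R]_N})
    (F : seq (set 'rV[R]_N)) : Prop :=
  [/\ uniq F,
      forall P, P \in F <-> facet K P &
      forall t, (2 <= t <= size F)%N ->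
        (exists2 S : set (set 'rV[R]_N),
           S `<=` ridge d (nth set0 F t.-1) &
           attaching_set F t = \bigcup_(G in S) G) /\
        ((exists2 n, n.+2 = d &
            homeomorphic (attaching_set F t) (@unit_ball R n)) \/
         homeomorphic (attaching_set F t) (@unit_sphere R d.-1))].

(* A collects the members of the j pairs: it has 2j elements and is closed
   under taking opposites. The last constraint is part of the notion of type:
   if i = 0 and j < d - 1, the union is neither a ball nor a sphere. *)
Definition has_type (R : realType) (N d : nat) (F : seq (set 'rV[R]_N))
    (t i j : nat) : Prop :=
  let P := nth set0 F t.-1 in
  let I := attaching_set F t in
  (exists A B : {fset set 'rV[R]_N},
    [/\ #|` A| = (2 * j)%N /\ #|` B| = i,
        forall G, G \in A -> exists2 G', G' \in A & opposite d P G G',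
        forall G, G \in B ->
          ridge d P G /\ (forall G', opposite d P G G' -> ~ (G' `<=` I)) &
        I = \bigcup_(G in [set` A]) G `|` \bigcup_(G in [set` B]) G])
  /\ (i <= d.-1)%N /\ (i = 0%N -> j = d.-1).

(* The face poset of F_1 `|` ... `|` F_t, ordered by inclusion through the
   canonical order of [set]. *)
Definition face_poset (R : realType) (N : nat) (K : {fset set 'rV[R]_N})
    (F : seq (set 'rV[R]_N)) (t : nat) : {fset set 'rV[R]_N} :=
  [fset G in K | has (fun H => `[< is_face H G >]) (take t F)]%fset.

(** * The contributions *)

Definition catalan (n : nat) : nat := ('C(2 * n, n) %/ n.+1)%N.

(* The binomial coefficient with lower index k - s vanishes for s > k, whence
   the guard: the subtraction of nat would give 'C(_, 0) = 1. *)
Definition toric_contrib (d i j : nat) : {poly int} :=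
  \sum_(k < d)
    (catalan (d - 1 - k))%:R * (1 - 'X) ^+ k * 'X^(d - k)
    * (\sum_(s < j.+1 | (s <= k)%N)
         'C(j, s) * 'C(d + i + j - 1 - k - s, k - s))%N%:R.

Definition toric_contrib_closed (d : nat) : {poly int} :=
  \sum_(k < d)
    (catalan (d - 1 - k) * 'C(d - 1 - k, k))%N%:R * ('X - 1) ^+ k.

(* Main.v *)
Require Import Defs.
From mathcomp Require Import all_boot all_order all_algebra finmap zify ring lra.
From mathcomp Require Import boolp classical_sets reals topology normedtype.

(* Split the sum defining f according to the facet F_t at which a face first
   appears: f(P_t) - f(P_(t-1)) is the sum of g(k-cube) (x-1)^(d-1-k) over the new
   k-faces of F_t.  For type (i, j) the new faces of the cube are those that are
   free in j directions and avoid one side in i further directions, so with y = x-1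
   and the functional L : z^k |-> g(k-cube) the difference is
   L(z^j (z+y)^i (z+2y)^(d-1-i-j)).  Pascal's rule reduces these values to
   L((z+2y)^n) = x^(n+1) g(n-cube, 1/x) - y^(n+1), with
   g(n-cube) = sum_k C_(n-k) binom(n-k, k) y^k.
   Both sides of the latter have generating functions A in u with
   (1-2yu) A = 1 + u (1-yu) A^2, which determines A.  The same identity gives
   Gessel's formula for g(n-cube) by induction on n: it says that (1-x) f agrees
   with that formula up to terms of degree greater than n/2.
   A face is new iff it lies in none of the listed (d-2)-faces, because a face
   contained in a finite union of faces is contained in one of them; the topology
   of the attaching set plays no role. *)

Set Implicit Arguments.
Unset Strict Implicit.
Unset Printing Implicit Defensive.

Import Order.TTheory GRing.Theory Num.Theory.
Local Open Scope ring_scope.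

(** * Generating functions of the cube polynomials *)

(** The division in [catalan] is exact: [n.+1] is coprime to [n] and divides [n * 'C(2 * n, n)],
    which equals [n.+1 * 'C(2 * n, n.+1)]. *)
Lemma catalanE n : (n.+1 * catalan n)%N = 'C(2 * n, n).
Proof.
rewrite /catalan mulnC divnK //.
have E : (n.+1 * 'C(2 * n, n.+1) = n * 'C(2 * n, n))%N.
  by rewrite mul_bin_left; congr (_ * _)%N; lia.
rewrite -(@Gauss_dvdr _ n) ?coprimeSn // -E.
by rewrite dvdn_mulr.
Qed.

Lemma catalanS n : (n.+2 * catalan n.+1 = (4 * n + 2) * catalan n)%N.
Proof.
rewrite catalanE.
have := mul_bin_diag (2 * n.+1) n; have := mul_bin_down (2 * n).+1 n.
have -> : (2 * n.+1).-1 = (2 * n).+1 by lia.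
rewrite /= -catalanE; set b := 'C(_, n); set c := 'C(_, _); nia.
Qed.

(** Weighting the convolution [S] by [i.+1] gives [W]. Reversing the summation ties [W m] to [S m],
    and [catalanS] expresses [W n.+1] through [W n] and [S n], so the values [S n] obey the
    recurrence of [catalanS]. *)
Lemma catalan_conv n :
  catalan n.+1 = (\sum_(i < n.+1) catalan i * catalan (n - i))%N.
Proof.
pose S m := (\sum_(i < m.+1) catalan i * catalan (m - i))%N.
pose W m := (\sum_(i < m.+1) i.+1 * catalan i * catalan (m - i))%N.
have WS m : (2 * W m = m.+2 * S m)%N.
  rewrite mul2n -addnn {2}/W (reindex_inj rev_ord_inj) /= -big_split big_distrr /=.
  apply: eq_bigr => i _; have := ltn_ord i; rewrite ltnS => lim.
  rewrite subSS subKn // (_ : m.+2 = i.+1 + (m - i).+1)%N; last by lia.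
  ring.
suff H : S n = catalan n.+1 by rewrite -H.
elim: n => [|n IH]; first by rewrite /S big_ord1.
have E : (W n.+1 = catalan n.+1 + \sum_(i < n.+1) (4 * i + 2) * catalan i * catalan (n - i))%N.
  rewrite /W big_ord_recl /= (_ : catalan 0 = 1%N) // subn0 !mul1n; congr (_ + _)%N.
  by apply: eq_bigr => i _; rewrite catalanS subSS.
have E2 : (\sum_(i < n.+1) (4 * i + 2) * catalan i * catalan (n - i) + 2 * S n = 4 * W n)%N.
  rewrite /S /W !big_distrr -big_split /=; apply: eq_bigr => i _.
  ring.
have := WS n; have := WS n.+1; have := catalanS n.+1; rewrite E; nia.
Qed.

(** * Power series represented by polynomials modulo a power of ['X] *)

Section PowerSeries.
Variable R : comNzRingType.
Implicit Types (p q u : {poly R}) (x y : R).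

Definition eqmod_Xn N p q := exists r, p = q + 'X^N * r.

Lemma eqmod_refl N p : eqmod_Xn N p p.
Proof. by exists 0; rewrite mulr0 addr0. Qed.

Lemma eqmod_sym N p q : eqmod_Xn N p q -> eqmod_Xn N q p.
Proof. by case=> r ->; exists (- r); ring. Qed.

Lemma eqmod_trans N p q u : eqmod_Xn N p q -> eqmod_Xn N q u -> eqmod_Xn N p u.
Proof. by case=> r -> [s ->]; exists (s + r); ring. Qed.

Lemma eqmodM N p q p' q' :
  eqmod_Xn N p p' -> eqmod_Xn N q q' -> eqmod_Xn N (p * q) (p' * q').
Proof.
case=> r -> [s ->]; exists (p' * s + r * q' + 'X^N * r * s); ring.
Qed.

Lemma eqmodD N p q p' q' :
  eqmod_Xn N p p' -> eqmod_Xn N q q' -> eqmod_Xn N (p + q) (p' + q').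
Proof. by case=> r -> [s ->]; exists (r + s); ring. Qed.

Lemma eqmod_sum N (I : Type) (s : seq I) (P : pred I) (E E' : I -> {poly R}) :
  (forall i, P i -> eqmod_Xn N (E i) (E' i)) ->
  eqmod_Xn N (\sum_(i <- s | P i) E i) (\sum_(i <- s | P i) E' i).
Proof.
move=> H; apply: (big_ind2 (eqmod_Xn N)) => //; first exact: eqmod_refl.
by move=> *; apply: eqmodD.
Qed.

Lemma eqmodP N p q :
  (forall i, (i < N)%N -> p`_i = q`_i) <-> eqmod_Xn N p q.
Proof.
split=> [H|[r ->] i iN]; last by rewrite coefD coefXnM iN addr0.
exists (drop_poly N (p - q)).
have /eqP := poly_take_drop N (p - q).
rewrite (_ : take_poly N _ = 0) ?add0r; last first.
  by apply/polyP=> i; rewrite coef_take_poly coefB coef0; case: ifP => // /H ->; rewrite subrr.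
by rewrite -subr_eq0 => /eqP E; rewrite mulrC; move/subr0_eq: E => ->; ring.
Qed.

(** Modulo ['X^N] the factor [1 - 'X * u] is a unit, with the truncated geometric sum as inverse. *)
Lemma eqmod_cancel N u p q :
  eqmod_Xn N ((1 - 'X * u) * p) ((1 - 'X * u) * q) -> eqmod_Xn N p q.
Proof.
case=> r E.
have G : (1 - 'X * u) * (\sum_(k < N) ('X * u) ^+ k) = 1 - 'X^N * u ^+ N.
  rewrite -exprMn -opprB mulNr -subrX1; ring.
set g := \sum_(_ < _) _ in G.
exists (u ^+ N * (p - q) + g * r).
have {}E : (1 - 'X^N * u ^+ N) * (p - q) = 'X^N * (g * r).
  rewrite -G; transitivity (g * ((1 - 'X * u) * p - (1 - 'X * u) * q)); first by ring.
  by rewrite E; ring.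
transitivity (q + ((1 - 'X^N * u ^+ N) * (p - q) + 'X^N * u ^+ N * (p - q))); first by ring.
by rewrite E; ring.
Qed.

Definition catalan_series N : {poly R} := \poly_(m < N) (catalan m)%:R.

(** The functional equation C = 1 + z C^2 is [catalan_conv] read on coefficients. Substituting
    ['X * u] for z keeps multiples of z^N divisible by ['X^N]. *)
Lemma catalan_series_eq N u : 
  eqmod_Xn N (catalan_series N \Po ('X * u))
     (1 + ('X * u) * (catalan_series N \Po ('X * u)) ^+ 2).
Proof.
have /eqmodP[r E] : forall i, (i < N)%N ->
   (catalan_series N)`_i = (1 + 'X * catalan_series N ^+ 2)`_i.
  case=> [|i] iN; rewrite coefD coefXM coef1 coef_poly iN /= ?addr0 //.
  rewrite add0r catalan_conv natr_sum expr2 coefM; apply: eq_bigr => j _.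
  have := ltn_ord j; rewrite ltnS => ji.
  by rewrite natrM !coef_poly !ifT //; lia.
rewrite {1}E !rmorphD rmorph1 !rmorphM /= comp_polyX.
exists (u ^+ N * (r \Po ('X * u))).
by rewrite comp_Xn_poly exprMn; ring.
Qed.

(** The summand of index [l] contributes through the coefficient of degree [n - l] in (1 + y X)^l;
    then [l = n - k]. The case [x = 1] yields the series of [cube_g], and [1 + y], [- y] in place of
    [x], [y] that of [cube_grev]. *)
Lemma coef_catalan_comp N n x y : (n < N)%N ->
  (catalan_series N \Po ('X * (x%:P * (1 + y%:P * 'X))))`_n =
  \sum_(k < n.+1) (catalan (n - k) * 'C(n - k, k))%:R * x ^+ (n - k) * y ^+ k.
Proof.
move=> nN; rewrite /catalan_series poly_def rmorph_sum coef_sum /=.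
transitivity (\sum_(l < n.+1) (catalan l * 'C(l, n - l))%:R * x ^+ l * y ^+ (n - l)).
  rewrite (big_ord_widen N (fun l => (catalan l * 'C(l, n - l))%:R * x ^+ l * y ^+ (n - l))) //.
  rewrite [RHS]big_mkcond; apply: eq_bigr => l _ /=.
  rewrite comp_polyZ comp_Xn_poly coefZ !exprMn coefXnM ltnS.
  case: ltnP => ln; first by rewrite mulr0.
  rewrite -polyC_exp coefCM exprDn coef_sum.
  under eq_bigr => i _ do
    rewrite expr1n mul1r exprMn -polyC_exp coefMn coefCM coefXn.
  case: (leqP (n - l) l) => nll.
    rewrite (bigD1 (inord (n - l))) //= inordK ?ltnS // eqxx mulr1.
    rewrite big1 ?addr0 => [|i]; first by rewrite natrM -mulr_natr; ring.
    rewrite -val_eqE /= inordK ?ltnS // eq_sym => /negPf ->.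
    by rewrite mulr0 mul0rn.
  rewrite big1 ?mulr0 ?bin_small ?muln0 ?mul0r // => i _.
  have := ltn_ord i; rewrite ltnS => il.
  by rewrite gtn_eqF ?mulr0 ?mul0rn //; apply: leq_ltn_trans nll.
rewrite (reindex_inj rev_ord_inj) /=; apply: eq_bigr => k _.
by have := ltn_ord k; rewrite ltnS subSS => kn; rewrite subKn.
Qed.

Definition cube_g y n : R :=
  \sum_(k < n.+1) (catalan (n - k) * 'C(n - k, k))%:R * y ^+ k.

(* Gessel's formula for the toric g-polynomial of the n-cube at x = 1 + y is
   [cube_g y n], and x^(n+1) times its value at 1/x is [(1 + y) * cube_grev y n]. *)
Definition cube_grev y n : R :=
  \sum_(k < n.+1) (catalan (n - k) * 'C(n - k, k))%:R * (1 + y) ^+ (n - k) * (- y) ^+ k.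

Lemma eqmod_geom N y :
  eqmod_Xn N ((1 - y%:P * 'X) * \poly_(k < N) y ^+ k) 1.
Proof.
rewrite poly_def; exists (- (y ^+ N)%:P).
rewrite (eq_bigr (fun k : 'I_N => (y%:P * 'X) ^+ k)); last first.
  by move=> k _; rewrite exprMn -polyC_exp mul_polyC.
rewrite -opprB mulNr -subrX1 exprMn -polyC_exp; ring.
Qed.

(** The expansion of (1 - y X)^(-m-1): by Pascal's rule, one factor 1 - y X lowers [m] by one. *)
Lemma eqmod_negbin N y m :
  eqmod_Xn N (\poly_(l < N) ('C(l + m, m)%:R * y ^+ l))
     ((\poly_(k < N) y ^+ k) ^+ m.+1).
Proof.
pose Q := \poly_(k < N) y ^+ k; rewrite -/Q.
pose S m := \poly_(l < N) ('C(l + m, m)%:R * y ^+ l); rewrite -/(S m).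
elim: m => [|m IH].
  by rewrite expr1; apply/eqmodP => i iN; rewrite !coef_poly iN bin0 mul1r.
rewrite exprS; have QS : eqmod_Xn N ((1 - y%:P * 'X) * S m.+1) (S m).
  apply/eqmodP => -[|i] iN; rewrite mulrBl mul1r coefB -mulrA coefCM coefXM !coef_poly iN /=.
    by rewrite !add0n !binn mulr0 subr0.
  rewrite ltnW // addSn binS -addSnnS natrD exprS; ring.
apply: eqmod_trans (eqmodM (eqmod_refl N Q) (eqmod_trans QS IH)).
rewrite mulrCA mulrA -[X in eqmod_Xn _ X _]mul1r.
by apply: eqmodM (eqmod_refl _ _); apply: eqmod_sym; exact: eqmod_geom.
Qed.

Lemma cube_g_binomial y n :
  \sum_(m < n.+1) 'C(n, m)%:R * (y *+ 2) ^+ (n - m) * cube_g y m =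
  (1 + y) * cube_grev y n - y ^+ n.+1.
Proof.
pose N := n.+1; pose D : {poly R} := 1 - (y *+ 2)%:P * 'X.
pose E : {poly R} := 1 - y%:P * 'X.
pose a n := \sum_(m < n.+1) 'C(n, m)%:R * (y *+ 2) ^+ (n - m) * cube_g y m.
pose b n := (1 + y) * cube_grev y n - y ^+ n.+1.
pose A := \poly_(k < N) a k; pose B := \poly_(k < N) b k.
(* With [Q] the inverse of [D] and G the series of [cube_g], negative binomial expansion gives A = Q
   G(X Q) = Q c. As G is a Catalan series in X (1 + y X), [c] is one in ['X * u], and [E * Q ^+ 2]
   agrees with [u]; the equation of [c] becomes that of [A]. *)
have quadA : eqmod_Xn N (D * A) (1 + 'X * E * A ^+ 2).
  pose Q := \poly_(k < N) (y *+ 2) ^+ k.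
  have [r0 DQ] : eqmod_Xn N (D * Q) 1 := eqmod_geom N (y *+ 2).
  pose v := 'X * Q; pose u := Q * (1 + y%:P * v).
  pose c := catalan_series N \Po ('X * u).
  have [r1 cE] : eqmod_Xn N c (1 + 'X * u * c ^+ 2) := catalan_series_eq N u.
  have [r2 AE] : eqmod_Xn N A (Q * c).
    apply: (@eqmod_trans _ _ (\sum_(m < N) (cube_g y m)%:P * 'X^m * Q ^+ m.+1)).
      apply: (@eqmod_trans _ _ (\sum_(m < N) (cube_g y m)%:P * 'X^m *
          \poly_(l < N) ('C(l + m, m)%:R * (y *+ 2) ^+ l))); last first.
        apply: eqmod_sum => m _; apply: eqmodM; first exact: eqmod_refl.
        exact: eqmod_negbin.
      apply/eqmodP => k kN; rewrite coef_poly kN coef_sum /a.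
      rewrite (big_ord_widen N (fun m => 'C(k, m)%:R * (y *+ 2) ^+ (k - m) * cube_g y m)) //.
      rewrite big_mkcond; apply: eq_bigr => m _ /=.
      rewrite -(mulrA _%:P) coefCM coefXnM ltnS leqNgt; case: ltnP => km /=; first by rewrite mulr0.
      by rewrite coef_poly subnK // ifT; [ring | lia].
    have [r3 gE] : eqmod_Xn N (\poly_(m < N) cube_g y m)
       (catalan_series N \Po ('X * (1%:P * (1 + y%:P * 'X)))).
      apply/eqmodP => k kN; rewrite coef_poly kN coef_catalan_comp //.
      by apply: eq_bigr => l _; rewrite expr1n mulr1.
    exists (Q * Q ^+ N * (r3 \Po v)).
    transitivity (Q * ((\poly_(m < N) cube_g y m) \Po v)).
      rewrite poly_def rmorph_sum mulr_sumr /=; apply: eq_bigr => m _.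
      by rewrite comp_polyZ comp_Xn_poly exprMn exprS -mul_polyC; ring.
    rewrite gE rmorphD rmorphM /= comp_Xn_poly -comp_polyA /c /u.
    rewrite !rmorphM rmorphD rmorphM /= !comp_polyC !comp_polyX rmorph1.
    rewrite [v ^+ N]exprMn.
    have -> : v * (1 * (1 + y%:P * v)) = 'X * (Q * (1 + y%:P * v)) by rewrite /v; ring.
    ring.
  have EQ : E * Q ^+ 2 = u + 'X^N * (Q * r0).
    transitivity ((D * Q) * Q + y%:P * 'X * Q ^+ 2); first by rewrite /D /E; ring.
    by rewrite DQ /u /v; ring.
  (* The quotient collects the remainders of the congruences for [D * Q], [c] and [A] as these are
     substituted. *)
  exists (r1 + r0 * c + D * r2
          - 'X * (Q * r0 * c ^+ 2 + E * r2 * (Q * c *+ 2 + 'X^N * r2))).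
  transitivity ((D * Q) * c + 'X^N * D * r2); first by rewrite AE; ring.
  transitivity (1 + 'X * ((E * Q ^+ 2) * c ^+ 2 + 'X^N * E * r2 * (Q * c *+ 2 + 'X^N * r2))
    + 'X^N * (r1 + r0 * c + D * r2
          - 'X * (Q * r0 * c ^+ 2 + E * r2 * (Q * c *+ 2 + 'X^N * r2)))); last first.
    by rewrite AE; ring.
  rewrite EQ DQ mulrDl mul1r {1}cE; ring.
(* Here [Q] is the inverse of [E], and B = (1 + y) c - y Q with [c] the Catalan series in ['X * u].
   The equation for [B] follows from that of [c] and [D = E - y%:P * 'X]. *)
have quadB : eqmod_Xn N (D * B) (1 + 'X * E * B ^+ 2).
  pose Q := \poly_(k < N) y ^+ k.
  have [r0 DQ] : eqmod_Xn N (E * Q) 1 := eqmod_geom N y.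
  pose u := (1 + y)%:P * E.
  pose c := catalan_series N \Po ('X * u).
  have [r1 cE] : eqmod_Xn N c (1 + 'X * u * c ^+ 2) := catalan_series_eq N u.
  have [r2 BE] : eqmod_Xn N B ((1 + y)%:P * c - y%:P * Q).
    apply/eqmodP => k kN; rewrite coef_poly kN coefB !coefCM coef_poly kN -exprS.
    rewrite /c /u /E -mulNr -polyCN coef_catalan_comp //.
  have xE : (1 + y)%:P = 1 + y%:P :> {poly R} by rewrite polyCD polyC1.
  pose B0 := (1 + y)%:P * c - y%:P * Q.
  have DE : D = E - y%:P * 'X by rewrite /E /D; ring.
  exists ((1 + y)%:P * r1 - y%:P * r0 - 'X * r0 * (y%:P ^+ 2 * Q - (1 + y)%:P * y%:P * c *+ 2)
      + D * r2 - 'X * E * r2 * (B0 *+ 2 + 'X^N * r2)).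
  have DB0 : D * B0 = (1 + y)%:P * (1 - y%:P * 'X *+ 2) * c - y%:P * (E * Q) + y%:P ^+ 2 * 'X * Q.
    by rewrite /B0 /D /E; ring.
  have EB0 : E * B0 ^+ 2 = (1 + y)%:P * (u * c ^+ 2) - (1 + y)%:P * y%:P * (E * Q) * c *+ 2
      + y%:P ^+ 2 * (E * Q) * Q.
    by rewrite /B0 /u; ring.
  transitivity (D * B0 + 'X^N * D * r2); first by rewrite BE /B0; ring.
  transitivity (1 + 'X * (E * B0 ^+ 2) + 'X * E * 'X^N * r2 * (B0 *+ 2 + 'X^N * r2)
     + 'X^N * ((1 + y)%:P * r1 - y%:P * r0 - 'X * r0 * (y%:P ^+ 2 * Q - (1 + y)%:P * y%:P * c *+ 2)
      + D * r2 - 'X * E * r2 * (B0 *+ 2 + 'X^N * r2))); last by rewrite BE /B0; ring.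
  rewrite DB0 EB0 DQ.
  have -> : (1 + y)%:P * (1 - y%:P * 'X *+ 2) * c
    = (1 + y)%:P * (1 + 'X * u * c ^+ 2 + 'X^N * r1) - (1 + y)%:P * y%:P * 'X *+ 2 * c.
    by rewrite -cE; ring.
  by rewrite xE; ring.
have : eqmod_Xn N A B.
  (* Subtracting the two quadratic equations factors as (1 - X (2y + E (A + B))) (A - B) = 0 modulo
     ['X^N]. *)
  apply: (@eqmod_cancel _ ((y *+ 2)%:P + E * (A + B))).
  case: quadA => r rE; case: quadB => s sE; exists (r - s).
  apply/eqP; rewrite -subr_eq0; apply/eqP.
  transitivity ((D * A - 'X * E * A ^+ 2) - (D * B - 'X * E * B ^+ 2) - 'X^N * (r - s)).
    by rewrite /D; ring.
  by rewrite rE sE; ring.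
by move/eqmodP/(_ n (ltnSn n)); rewrite !coef_poly ltnSn.
Qed.

(* The functional L of the header, sending 'X^m to the g-polynomial of the m-cube. *)
Definition cube_umbra y p : R := \sum_(m < size p) p`_m * cube_g y m.

Lemma cube_umbra_widen M y p : (size p <= M)%N ->
  cube_umbra y p = \sum_(m < M) p`_m * cube_g y m.
Proof.
move=> sM; rewrite /cube_umbra (big_ord_widen M (fun m => p`_m * cube_g y m)) //.
rewrite big_mkcond; apply: eq_bigr => m _; case: ltnP => // ms.
by rewrite nth_default // mul0r.
Qed.

Lemma cube_umbraD y : {morph cube_umbra y : p q / p + q}.
Proof.
move=> p q; rewrite (@cube_umbra_widen (maxn (size p) (size q)) _ (p + q)) ?size_polyD //.
rewrite (@cube_umbra_widen (maxn (size p) (size q)) _ p) ?leq_maxl //.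
rewrite (@cube_umbra_widen (maxn (size p) (size q)) _ q) ?leq_maxr //.
by rewrite -big_split; apply: eq_bigr => m _; rewrite coefD mulrDl.
Qed.

Lemma cube_umbraM y c p : cube_umbra y (c%:P * p) = c * cube_umbra y p.
Proof.
rewrite (@cube_umbra_widen (size p)) ?mulr_sumr; last by rewrite mul_polyC size_scale_leq.
by apply: eq_bigr => m _; rewrite coefCM mulrA.
Qed.

Lemma cube_umbra_sum y (I : Type) (s : seq I) (P : pred I) (E : I -> {poly R}) :
  cube_umbra y (\sum_(i <- s | P i) E i) = \sum_(i <- s | P i) cube_umbra y (E i).
Proof.
apply: (big_morph _ (cube_umbraD y)).
by rewrite /cube_umbra size_poly0 big_ord0.
Qed.

Lemma cube_umbraXn y n : cube_umbra y 'X^n = cube_g y n.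
Proof.
rewrite /cube_umbra size_polyXn (bigD1 ord_max) //= coefXn eqxx mul1r big1 ?addr0 // => m.
by rewrite -val_eqE /= coefXn => /negPf ->; rewrite mul0r.
Qed.

(** * Contributions of the types and their recurrences *)

Definition contrib_bin n i j k : nat :=
  \sum_(s < j.+1) 'C(j, s) * (if (s <= k)%N then 'C(n + i + j - k - s, k - s) else 0).

(** This is [toric_contrib] with [n] for d - 1 and [y] for x - 1. *)
Definition cube_contrib y n i j : R :=
  \sum_(k < n.+1) (catalan (n - k))%:R * (- y) ^+ k * (1 + y) ^+ (n.+1 - k)
     * (contrib_bin n i j k)%:R.

Lemma contrib_bin0 n i j : contrib_bin n i j 0 = 1%N.
Proof.
rewrite /contrib_bin big_ord_recl /= bin0 bin0 big1 // => s _.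
by rewrite muln0.
Qed.

(** Pascal's rule in every summand with [s <= k]. At [s = k.+1] both binomials with lower index 0
    equal 1, and the guard makes the remaining term 0. *)
Lemma contrib_binSi n i j k : (k <= n)%N ->
  contrib_bin n.+1 i.+1 j k.+1 = (contrib_bin n.+1 i j k.+1 + contrib_bin n i j k)%N.
Proof.
move=> kn; rewrite /contrib_bin -big_split; apply: eq_bigr => s _ /=.
have := ltn_ord s; rewrite ltnS => sj; rewrite -mulnDr; congr (_ * _)%N.
case: (ltngtP s k.+1) => [|sk|->]; rewrite ?leqnn ?ltnn ?subnn ?bin0 //.
  rewrite ltnS => sk; rewrite sk.
  have -> : (n.+1 + i.+1 + j - k.+1 - s = (n + i + j - k - s).+1)%N by lia.
  have -> : (n.+1 + i + j - k.+1 - s = n + i + j - k - s)%N by lia.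
  by rewrite subSn // binS addnC.
by rewrite ifF // leqNgt (ltn_trans _ sk).
Qed.

(** Pascal's rule for the outer coefficient ['C(j.+1, s.+1)]: the part with ['C(j, s.+1)] rebuilds
    the sum for [i.+1], the part with ['C(j, s)] is the sum for [n] and [k] after a shift of [s]. *)
Lemma contrib_binSj n i j k :
  contrib_bin n.+1 i j.+1 k.+1 = (contrib_bin n.+1 i.+1 j k.+1 + contrib_bin n i j k)%N.
Proof.
rewrite /contrib_bin big_ord_recl bin0 mul1n [X in (X + _)%N]/=.
under eq_bigr => s _ do rewrite lift0 binS mulnDl.
rewrite big_split /= addnA; congr (_ + _)%N.
  rewrite big_ord_recr /= (bin_small (ltnSn j)) mul0n addn0 [RHS]big_ord_recl /= bin0 mul1n.
  congr (_ + _)%N; first by congr 'C(_, _); lia.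
  by apply: eq_bigr => s _; rewrite /bump /=; congr (_ * _)%N; case: ifP => // _; congr 'C(_, _); lia.
by apply: eq_bigr => s _; congr (_ * _)%N; rewrite ltnS; case: ifP => // _; congr 'C(_, _); lia.
Qed.

Lemma cube_contribSi y n i j :
  cube_contrib y n.+1 i.+1 j = cube_contrib y n.+1 i j - y * cube_contrib y n i j.
Proof.
rewrite /cube_contrib !(big_ord_recl n.+1) !contrib_bin0 -addrA; congr (_ + _).
rewrite mulr_sumr -sumrB; apply: eq_bigr => k _.
have := ltn_ord k; rewrite ltnS => kn.
by rewrite lift0 contrib_binSi // natrD !subSS exprS; ring.
Qed.

Lemma cube_contribSj y n i j :
  cube_contrib y n.+1 i j.+1 = cube_contrib y n.+1 i.+1 j - y * cube_contrib y n i j.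
Proof.
rewrite /cube_contrib !(big_ord_recl n.+1) !contrib_bin0 -addrA; congr (_ + _).
rewrite mulr_sumr -sumrB; apply: eq_bigr => k _.
by rewrite lift0 contrib_binSj natrD !subSS exprS; ring.
Qed.

Lemma cube_contrib00 y n : cube_contrib y n 0 0 = (1 + y) * cube_grev y n.
Proof.
rewrite /cube_contrib /cube_grev mulr_sumr; apply: eq_bigr => k _.
have := ltn_ord k; rewrite ltnS => kn.
by rewrite /contrib_bin big_ord1 /= !addn0 !subn0 mul1n natrM subSn // exprS; ring.
Qed.

Lemma cube_umbra_binomial y n :
  cube_umbra y (('X + (y *+ 2)%:P) ^+ n) = cube_contrib y n 0 0 - y ^+ n.+1.
Proof.
rewrite cube_contrib00 -cube_g_binomial addrC exprDn cube_umbra_sum.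
apply: eq_bigr => m _; rewrite -polyC_exp -mulr_natl -polyC1 -polyCMn mulrA -polyCM.
by rewrite cube_umbraM cube_umbraXn.
Qed.

(** Induction on [j] by z = (z+y) - y, then on [i] by z+y = (z+2y) - y, matching [cube_contribSj]
    and [cube_contribSi]. In the base case the two correction terms [y ^+ n.+1] of
    [cube_umbra_binomial] cancel, which takes one factor z+y; hence the exponent [i.+1]. *)
Lemma cube_umbra_shape y i j l :
  cube_umbra y ('X^j * ('X + y%:P) ^+ i.+1 * ('X + (y *+ 2)%:P) ^+ l) =
  cube_contrib y (i.+1 + j + l) i.+1 j.
Proof.
have Sl (p q : {poly R}) m : p * ('X + y%:P) * q ^+ m =
    p * q ^+ m.+1 + (- y)%:P * (p * q ^+ m) + p * q ^+ m * ('X + (y *+ 2)%:P - q).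
  by rewrite exprSr polyCN polyCMn; ring.
elim: j i l => [|j IH] i l.
  rewrite addn0; elim: i l => [|i IH] l.
    rewrite expr1 Sl subrr mulr0 addr0 expr0 !mul1r.
    rewrite cube_umbraD cube_umbraM !cube_umbra_binomial add1n cube_contribSi !exprS; ring.
  rewrite (exprSr _ i.+1) mulrA Sl subrr mulr0 addr0.
  by rewrite cube_umbraD cube_umbraM !IH addnS !addSn [RHS]cube_contribSi mulNr.
have -> : 'X^(j.+1) * ('X + y%:P) ^+ i.+1 * ('X + (y *+ 2)%:P) ^+ l
   = 'X^j * ('X + y%:P) ^+ i.+2 * ('X + (y *+ 2)%:P) ^+ l
     + (- y)%:P * ('X^j * ('X + y%:P) ^+ i.+1 * ('X + (y *+ 2)%:P) ^+ l).
  by rewrite !(exprS _ i.+1) (exprS _ j) polyCN; ring.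
by rewrite cube_umbraD cube_umbraM !IH addnS !addSn [RHS]cube_contribSj mulNr.
Qed.

End PowerSeries.

(** * Specialization to integer polynomials at y = x - 1 *)

Lemma toric_contribE n i j :
  toric_contrib n.+1 i j = cube_contrib ('X - 1) n i j :> {poly int}.
Proof.
rewrite /toric_contrib /cube_contrib; apply: eq_bigr => k _.
rewrite subSS subn0 opprB (addrC 1 ('X - 1)) subrK; congr (_ * _%:R).
rewrite /contrib_bin big_mkcond; apply: eq_bigr => s _ /=.
case: ifP => _; last by rewrite muln0.
by rewrite !addSn subn1.
Qed.

Lemma toric_contrib_closedE n :
  toric_contrib_closed n.+1 = cube_g ('X - 1) n :> {poly int}.
Proof.
rewrite /toric_contrib_closed /cube_g; apply: eq_bigr => k _.
by rewrite subSS subn0.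
Qed.

Lemma size_cube_g n : (size (cube_g ('X - 1) n : {poly int}) <= n./2.+1)%N.
Proof.
apply: (leq_trans (size_sum _ _ _)); apply/bigmax_leqP => k _.
case: (leqP k (n - k)) => kn; last by rewrite bin_small // muln0 mul0r size_poly0.
rewrite -polyC_natr mul_polyC (leq_trans (size_scale_leq _ _)) // size_exp_XsubC.
by lia.
Qed.

(** The differences k_i - k_(i-1) are the coefficients of (1 - X) f. A nonzero term of
    ['X * cube_grev] has [k <= n - k] and is divisible by ['X^((n - k).+1)], so it contributes
    nothing in degrees up to n/2. *)
Lemma toric_trunc_cube n f :
  ('X - 1) * f = ('X * cube_grev ('X - 1) n - cube_g ('X - 1) n : {poly int}) ->
  toric_trunc n f = cube_g ('X - 1) n.
Proof.
move=> E; apply/polyP => i; rewrite coef_poly; case: ltnP => iN; last first.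
  by rewrite nth_default // (leq_trans (size_cube_g n)).
have -> : f`_i - (if i is i'.+1 then f`_i' else 0) = - (('X - 1) * f)`_i.
  by rewrite mulrBl mul1r coefB coefXM; case: (i) => [|i'] /=; ring.
rewrite E coefB /cube_grev mulr_sumr coef_sum big1 ?sub0r ?opprK // => k _.
rewrite (addrC 1 ('X - 1)) subrK.
case: (leqP k (n - k)) => kn; last by rewrite bin_small // muln0 !mul0r mulr0 coef0.
have -> (a b : {poly int}) : 'X * (a * 'X^(n - k) * b) = a * b * 'X^((n - k).+1).
  by rewrite exprS; ring.
by rewrite coefMXn ifT //; lia.
Qed.

(** * Heights and ranks *)

Section Heights.
Context (disp : Order.disp_t) (T : porderType disp).
Implicit Types (P c : {fset T}) (s t : T).

Lemma height_leP P m :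
  reflect (forall c, (c `<=` P)%fset ->
             {in c &, forall s t, (s >=< t)%O} -> (#|` c| <= m.+1)%N)
    (height P <= m)%N.
Proof.
apply: (iffP (bigmax_leqP_seq _ _ _ _)) => H c.
  move=> cP cc; suff : (#|` c|.-1 <= m)%N by lia.
  apply: H; first by rewrite fpowersetE.
  by apply/allrelP => s t sc tc; apply: cc.
rewrite fpowersetE => cP /allrelP cc.
have := H c cP (fun s t sc tc => cc s t sc tc); lia.
Qed.

Lemma chain_card_height P c : (c `<=` P)%fset ->
  {in c &, forall s t, (s >=< t)%O} -> (#|` c| <= (height P).+1)%N.
Proof. by move=> cP cc; have /height_leP := leqnn (height P); apply. Qed.

Lemma le_height P Q : (P `<=` Q)%fset -> (height P <= height Q)%N.
Proof.
by move=> PQ; apply/height_leP => c cP; apply: chain_card_height (fsubset_trans cP PQ).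
Qed.

(** The maximum is found as an element with the most members of [c] below it. *)
Lemma chain_max c : {in c &, forall s t, (s >=< t)%O} -> c != fset0 ->
  exists2 t, t \in c & forall s, s \in c -> (s <= t)%O.
Proof.
move=> cc /fset0Pn[x xc].
pose f (u : c) := #|` [fset s in c | (s <= val u)%O]%fset|.
case: (@arg_maxnP _ [` xc]%fset xpredT f isT) => u _ umax.
exists (val u); first exact: valP.
move=> s sc; have /orP[//|us] := cc _ _ sc (valP u).
have := umax [` sc]%fset isT; rewrite /f /= => le.
have [->//|ne] := eqVneq s (val u).
have : (#|` [fset s in c | (s <= val u)%O]%fset| < #|` [fset s0 in c | (s0 <= s)%O]%fset|)%N.
  apply: fproper_ltn_card; rewrite fproperE; apply/andP; split.
    by apply/fsubsetP => v; rewrite !inE => /andP[-> /le_trans ->].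
  apply/fsubsetPn; exists s; rewrite !inE sc ?lexx //=.
  by apply: contra ne => su; rewrite eq_le su us.
by rewrite ltnNge le.
Qed.

Lemma prank_le_height P t : (prank P t <= height P)%N.
Proof. by apply: le_height; apply/fsubsetP => s; rewrite !inE => /andP[]. Qed.

Lemma height_le_prank P m :
  (forall t, t \in P -> (prank P t <= m)%N) -> (height P <= m)%N.
Proof.
move=> H; apply/height_leP => c cP cc.
have [->|c0] := eqVneq c fset0; first by rewrite cardfs0.
have [t tc tmax] := chain_max cc c0.
apply: (@leq_trans (prank P t).+1); last by rewrite ltnS H // (fsubsetP cP).
apply: chain_card_height cc; apply/fsubsetP => s sc.
by rewrite !inE (fsubsetP cP) // tmax.
Qed.

(** Adjoining [t] to a chain of elements at most [s] lengthens it by one. *)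
Lemma prank_lt P s t : s \in P -> t \in P -> (s < t)%O -> (prank P s < prank P t)%N.
Proof.
move=> sP tP st.
suff H c : (c `<=` [fset u in P | (u <= s)%O])%fset ->
    {in c &, forall s t, (s >=< t)%O} -> (#|` c| <= prank P t)%N.
  have p0 : (0 < prank P t)%N.
    have := H [fset s]%fset; rewrite cardfs1; apply.
      by apply/fsubsetP => u; rewrite !inE => /eqP ->; rewrite sP lexx.
    by move=> u v; rewrite !inE => /eqP -> /eqP ->; exact: comparablexx.
  rewrite -(prednK p0) ltnS; apply/height_leP => c cP cc.
  by rewrite prednK //; apply: H.
move=> cP cc.
have tc : t \notin c.
  by apply/negP => /(fsubsetP cP); rewrite !inE => /andP[_ /(lt_le_trans st)]; rewrite ltxx.
have := @chain_card_height [fset u in P | (u <= t)%O]%fset (t |` c)%fset.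
rewrite cardfsU1 tc add1n ltnS; apply.
  apply/fsubsetP => u; rewrite !inE => /orP[/eqP ->|]; first by rewrite tP lexx.
  by move=> /(fsubsetP cP); rewrite !inE => /andP[-> /le_trans ->] //; apply: ltW.
have ct u : u \in c -> (u <= t)%O.
  by move=> /(fsubsetP cP); rewrite !inE => /andP[_ /le_trans ->] //; apply: ltW.
move=> u v; rewrite !inE => /orP[/eqP ->|uc] /orP[/eqP ->|vc].
- exact: comparablexx.
- by rewrite comparable_sym le_comparable // ct.
- by rewrite le_comparable // ct.
- exact: cc.
Qed.

(** Remove [t] from a chain: what is left is empty or has a maximum strictly below [t], whose rank
    bounds its length. *)
Lemma prank_leS P t m : (forall s, s \in P -> (s < t)%O -> (prank P s < m)%N) ->
  (prank P t <= m)%N.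
Proof.
move=> H; apply/height_leP => c cP cc.
have [c0|c0] := eqVneq (c `\ t)%fset fset0.
  have : (#|` (c `\ t)%fset| = 0)%N by rewrite c0 cardfs0.
  by rewrite (cardfsD1 t c) => ->; case: (t \in c).
have cc' : {in (c `\ t)%fset &, forall s t, (s >=< t)%O}.
  by move=> u v; rewrite !inE => /andP[_ uc] /andP[_ vc]; apply: cc.
have [s sc smax] := chain_max cc' c0.
move: (sc); rewrite !inE => /andP[sNt /(fsubsetP cP)]; rewrite !inE => /andP[sP st].
have := H s sP; rewrite lt_neqAle sNt st => /(_ isT) => sm.
rewrite (cardfsD1 t c); apply: (@leq_trans (1 + (prank P s).+1)); last by rewrite add1n ltnS.
rewrite leq_add // ?leq_b1 //; apply: chain_card_height cc'.
apply/fsubsetP => u uc; rewrite !inE smax // andbT.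
by move: uc; rewrite !inE => /andP[_ /(fsubsetP cP)]; rewrite !inE => /andP[].
Qed.

Lemma mem_below P s t : (s \in below P t) = (s \in P) && (s < t)%O.
Proof. by rewrite !inE. Qed.

Lemma below_below P s t : (s < t)%O -> below (below P t) s = below P s.
Proof.
move=> st; apply/fsetP => u; rewrite !mem_below -andbA; congr (_ && _).
by apply/andP/idP => [[]//|us]; split=> //; apply: lt_trans st.
Qed.

Lemma prank_below P s t : (s < t)%O -> prank (below P t) s = prank P s.
Proof.
move=> st; rewrite /prank; congr height; apply/fsetP => u; rewrite !inE -andbA; congr (_ && _).
by apply/andP/idP => [[]//|us]; split=> //; apply: le_lt_trans st.
Qed.

Section LowerSet.
Variables P Q : {fset T}.
Hypothesis QP : (Q `<=` P)%fset.
Hypothesis Qlow : forall s t, s \in P -> t \in Q -> (s <= t)%O -> s \in Q.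

Lemma below_lower t : t \in Q -> below Q t = below P t.
Proof.
move=> tQ; apply/fsetP => u; rewrite !mem_below; apply/andP/andP => -[uQ ut].
  by split=> //; exact: (fsubsetP QP).
by split=> //; apply: Qlow (ltW ut).
Qed.

Lemma prank_lower t : t \in Q -> prank Q t = prank P t.
Proof.
move=> tQ; rewrite /prank; congr height; apply/fsetP => u; rewrite !inE.
apply/andP/andP => -[uQ ut]; first by split=> //; exact: (fsubsetP QP).
by split=> //; apply: Qlow ut.
Qed.

(** An element of the lower set [Q] has the same elements below it and the same rank in [P]; with
    equal heights its two summands coincide and cancel. *)
Lemma toric_f_lower : Q != fset0 -> height P = height Q ->
  toric_f P - toric_f Q =
  \sum_(t <- P | t \notin Q) toric_g (below P t) * ('X - 1) ^+ (height P - prank P t).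
Proof.
move=> Q0 hPQ.
have P0 : P != fset0.
  by apply: contra Q0 => /eqP PE; rewrite -fsubset0 -PE.
rewrite /toric_f (negPf Q0) (negPf P0) (bigID (mem Q)) /= addrC.
apply: (canLR (addrK _)); congr (_ + _).
have -> : \sum_(t <- P | t \in Q) toric_g (below P t) * ('X - 1) ^+ (height P - prank P t)
   = \sum_(t <- Q) toric_g (below P t) * ('X - 1) ^+ (height P - prank P t).
  rewrite -big_filter; apply: perm_big; apply: uniq_perm; rewrite ?filter_uniq ?fset_uniq //.
  by move=> t; rewrite mem_filter; case: (boolP (t \in Q)) => //= /(fsubsetP QP) ->.
by apply: eq_big_seq => t tQ; rewrite below_lower // prank_lower // hPQ.
Qed.

End LowerSet.
End Heights.

(** * Cubical intervals *)

(* The faces of the cube [0, 1]^I: [None] is the empty face, and [Some s] fixes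
   the coordinate i to b when [s i = Some b] and leaves it free when
   [s i = None]. *)
Definition cell (I : finType) := option {ffun I -> option bool}.

Definition cell_le (I : finType) (a b : cell I) : bool :=
  match a, b with
  | None, _ => true
  | Some _, None => false
  | Some s, Some t => [forall i, (t i == None) || (s i == t i)]
  end.

Definition cell_dim (I : finType) (s : {ffun I -> option bool}) : nat :=
  #|[set i | s i == None]|.

Lemma big_option (R : Type) (idx : R) (op : Monoid.com_law idx) (J : finType)
    (p : pred (option J)) (E : option J -> R) :
  \big[op/idx]_(a | p a) E a =
  op (if p None then E None else idx) (\big[op/idx]_(j | p (Some j)) E (Some j)).
Proof.
rewrite big_mkcond (bigD1 None) //=; congr (op _ _).
rewrite (reindex_omap Some id) /=; last by case.
by rewrite -big_mkcondr; apply: eq_bigl => j; rewrite eqxx.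
Qed.

Section Cells.
Variable I : finType.
Implicit Types (s t : {ffun I -> option bool}) (a b : cell I).

Lemma cell_leP s t : reflect (forall i, t i = None \/ s i = t i) (cell_le (Some s) (Some t)).
Proof.
apply: (iffP forallP) => H i.
  by have /orP[/eqP|/eqP] := H i; [left|right].
by have [->|->] := H i; rewrite eqxx ?orbT.
Qed.

Lemma cell_le_refl a : cell_le a a.
Proof. by case: a => // s; apply/cell_leP => i; right. Qed.

Lemma cell_le_anti a b : cell_le a b -> cell_le b a -> a = b.
Proof.
case: a b => [s|] [t|] // /cell_leP st /cell_leP ts; congr Some; apply/ffunP => i.
by have [E|//] := st i; have [E'|//] := ts i; rewrite E E'.
Qed.

Lemma cell_dim_lt s t : cell_le (Some s) (Some t) -> s != t -> (cell_dim s < cell_dim t)%N.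
Proof.
move=> /cell_leP st nst; apply: proper_card; rewrite properE; apply/andP; split.
  apply/fintype.subsetP => i; rewrite !inE => /eqP si; have [->//|<-] := st i.
  by rewrite si.
apply: contra nst => /fintype.subsetP ts; apply/eqP/ffunP => i.
have [ti|//] := st i; have := ts i; rewrite !inE ti eqxx => /(_ isT) /eqP //.
Qed.

Lemma cell_dim_facet s : (0 < cell_dim s)%N ->
  exists2 t, cell_le (Some t) (Some s) & (cell_dim t).+1 = cell_dim s.
Proof.
rewrite /cell_dim card_gt0 => /set0Pn[i]; rewrite inE => /eqP si.
exists [ffun j => if j == i then Some true else s j].
  by apply/cell_leP => j; rewrite ffunE; case: eqP => [->|]; [left | right].
rewrite [RHS](cardsD1 i) inE si eqxx add1n; congr _.+1.
by apply: eq_card => j; rewrite !inE ffunE; case: (j == i).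
Qed.

(* For a free coordinate [None] contributes the umbral variable and each fixed
   value y; the coordinates outside J are those that contribute no power of y. *)
Lemma sum_cells (R : comNzRingType) (y : R) (ok : I -> pred (option bool)) (J : pred I) :
  \sum_(s in family ok) cube_g y (cell_dim s) * y ^+ #|[set i | J i & s i != None]|
  = cube_umbra y (\prod_i \sum_(o | ok i o)
      (if o is None then 'X else if J i then y%:P else 1)).
Proof.
rewrite bigA_distr_big_dep cube_umbra_sum; apply: eq_bigr => s _.
transitivity (cube_umbra y ((y ^+ #|[set i | J i & s i != None]|)%:P * 'X^(cell_dim s))).
  by rewrite cube_umbraM cube_umbraXn mulrC.
congr cube_umbra; rewrite /cell_dim polyC_exp -!prodr_const.
rewrite big_mkcond [X in _ * X]big_mkcond -big_split; apply: eq_bigr => i _.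
by rewrite !inE; case: (s i) => [b|] /=; case: (J i) => /=; rewrite ?mulr1 ?mul1r.
Qed.

End Cells.

(** * Ranks and toric polynomials of cubical intervals *)

Section CubeIntervals.
Context (disp : Order.disp_t) (T : porderType disp) (I : finType).
Implicit Types (P : {fset T}) (s t : {ffun I -> option bool}) (a b : cell I).

(** An embedding of the face lattice of a cube as a lower set of [P], so that ranks and sets [below]
    of its members can be computed among cells. *)
Definition cube_interval P (phi : cell I -> T) : Prop :=
  [/\ forall a, phi a \in P,
      forall u a, u \in P -> (u <= phi a)%O -> exists b, u = phi b &
      forall a b, (phi a <= phi b)%O = cell_le a b].

Variables (P : {fset T}) (phi : cell I -> T).
Hypothesis phiP : cube_interval P phi.

Lemma cube_interval_inj : injective phi.
Proof.
case: phiP => _ _ le a b ab; apply: cell_le_anti; rewrite -le ab; exact: lexx.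
Qed.

Lemma cube_interval_mem a : phi a \in P. Proof. by case: phiP. Qed.

Lemma cube_interval_lt a b : (phi a < phi b)%O = cell_le a b && (a != b).
Proof.
by case: phiP => _ _ le; rewrite lt_neqAle le andbC (inj_eq cube_interval_inj).
Qed.

Lemma cube_interval_below u a : u \in P -> (u < phi a)%O ->
  exists2 b, u = phi b & cell_le b a && (b != a).
Proof.
move=> uP ua; case: phiP => _ /(_ _ _ uP (ltW ua))[b E] _.
by exists b => //; rewrite -cube_interval_lt -E.
Qed.

Lemma prank_empty_cell : prank P (phi None) = 0%N.
Proof.
apply/eqP; rewrite -leqn0; apply: prank_leS => u uP.
by move=> /(cube_interval_below uP)[[s|] _] //=; rewrite eqxx.
Qed.

Lemma prank_cell s : prank P (phi (Some s)) = (cell_dim s).+1.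
Proof.
have [m] := ubnP (cell_dim s); elim: m s => // m IH s; rewrite ltnS => sm.
apply/eqP; rewrite eqn_leq; apply/andP; split.
  apply: prank_leS => u uP /(cube_interval_below uP)[[t|] -> /andP[ts nts]].
    have lts : (cell_dim t < cell_dim s)%N by apply: cell_dim_lt.
    by rewrite IH ?ltnS // (leq_trans lts).
  by rewrite prank_empty_cell.
have [s0|s0] := posnP (cell_dim s).
  rewrite s0; apply: (@leq_ltn_trans (prank P (phi None))) => //.
  by apply: prank_lt; rewrite ?cube_interval_mem // cube_interval_lt.
have [t ts E] := cell_dim_facet s0; rewrite -E.
rewrite -(IH t) ?(leq_trans _ sm) ?E //; apply: prank_lt; rewrite ?cube_interval_mem //.
rewrite cube_interval_lt ts /=; apply/eqP => -[st]; move: E; rewrite st; lia.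
Qed.

Lemma height_below_cell s : height (below P (phi (Some s))) = cell_dim s.
Proof.
apply/eqP; rewrite eqn_leq; apply/andP; split.
  apply: height_le_prank => u; rewrite mem_below => /andP[uP us].
  by rewrite prank_below // -ltnS -prank_cell prank_lt ?cube_interval_mem.
have H a : cell_le a (Some s) && (a != Some s) ->
    (prank P (phi a) <= height (below P (phi (Some s))))%N.
  rewrite -cube_interval_lt => lt; rewrite -(prank_below P lt).
  by apply: prank_le_height.
have [->//|s0] := posnP (cell_dim s).
have [t ts E] := cell_dim_facet s0; rewrite -E -prank_cell; apply: H.
rewrite ts /=; apply/eqP => -[st]; move: E; rewrite st; lia.
Qed.

Lemma sum_cube_interval (V : nmodType) (Q : {fset T}) (q : pred T) (p : pred (cell I))
    (E : T -> V) :
  (forall u, u \in Q -> q u -> exists2 a, p a & u = phi a) ->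
  (forall a, p a -> (phi a \in Q) && q (phi a)) ->
  \sum_(u <- Q | q u) E u = \sum_(a | p a) E (phi a).
Proof.
move=> Qp pQ; rewrite -big_filter -[RHS]big_filter -(big_map phi xpredT E).
apply: perm_big; apply: uniq_perm; first by rewrite filter_uniq ?fset_uniq.
  by rewrite (map_inj_uniq cube_interval_inj) filter_uniq ?index_enum_uniq.
move=> u; rewrite mem_filter; apply/andP/mapP => [[qu uQ]|[a]].
  by have [a pa ->] := Qp u uQ qu; exists a; rewrite ?mem_filter ?pa ?mem_index_enum.
by rewrite mem_filter => /andP[/pQ /andP[? ?] _] ->.
Qed.

(** By induction on the dimension, y times [toric_f] of the proper faces is L((z+2y)^k) without the
    term of the full cube, plus y^(k+1) for the empty face. By [cube_umbra_binomial] this is the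
    hypothesis of [toric_trunc_cube]. *)
Lemma toric_g_below_cell s :
  toric_g (below P (phi (Some s))) = cube_g ('X - 1) (cell_dim s).
Proof.
have [m] := ubnP (cell_dim s); elim: m s => // m IH s; rewrite ltnS => sm.
set k := cell_dim s; set B := below P _.
have NB : phi None \in B by rewrite mem_below cube_interval_mem cube_interval_lt.
have B0 : B != fset0 by apply/fset0Pn; exists (phi None).
rewrite toric_gE (negPf B0) height_below_cell; apply: toric_trunc_cube.
pose y : {poly int} := 'X - 1.
have -> : toric_f B = y ^+ k + \sum_(t | cell_le (Some t) (Some s) && (t != s))
    cube_g y (cell_dim t) * y ^+ (k - (cell_dim t).+1).
  rewrite /toric_f (negPf B0) height_below_cell.
  rewrite (sum_cube_interval (p := fun a => cell_le a (Some s) && (a != Some s))).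
  - rewrite big_option /= below_below ?cube_interval_lt //.
    rewrite prank_below ?cube_interval_lt // prank_empty_cell subn0; congr (_ + _).
      suff -> : below P (phi None) = fset0 by rewrite toric_gE eqxx mul1r.
      apply/eqP; rewrite -fsubset0; apply/fsubsetP => u; rewrite mem_below => /andP[uP].
      by move=> /(cube_interval_below uP)[[t|] _] //=; rewrite eqxx.
    apply: eq_bigr => t /andP[ts nts].
    have lt : (phi (Some t) < phi (Some s))%O by rewrite cube_interval_lt; apply/andP.
    rewrite below_below ?prank_below // prank_cell IH //.
    by apply: leq_trans sm; apply: cell_dim_lt.
  - move=> u; rewrite mem_below => /andP[uP us] _.
    by have [a -> ?] := cube_interval_below uP us; exists a.
  - by move=> a; rewrite -cube_interval_lt mem_below andbT cube_interval_mem.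
rewrite mulrDr -exprS mulr_sumr.
(* Only directions free in [s] count towards the power of y: each of them yields a factor z+2y, each
   fixed one a factor 1. *)
pose J i := s i == None; pose ok i (o : option bool) := J i || (o == s i).
have okE t : (t \in family ok) = cell_le (Some t) (Some s).
  by apply: eq_forallb => i.
have := sum_cells y ok J.
have -> : \prod_i \sum_(o | ok i o) (if o is None then 'X else if J i then y%:P else 1)
   = ('X + (y *+ 2)%:P) ^+ k.
  rewrite /k /cell_dim -prodr_const [RHS]big_mkcond; apply: eq_bigr => i _.
  rewrite inE -/(J i) big_option; case: (boolP (J i)) => Ji.
    have ok1 o : ok i o by rewrite /ok Ji.
    by rewrite ok1; under eq_bigl => b do rewrite ok1; rewrite big_bool polyCMn mulr2n.
  move: Ji; rewrite /ok /J; case: (s i) => [b|] // _; rewrite /= add0r.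
  by rewrite (big_pred1 b).
rewrite cube_umbra_binomial cube_contrib00 (bigD1 s) /=; last by rewrite okE cell_le_refl.
rewrite [X in cube_g _ _ * y ^+ X](_ : _ = 0%N); last first.
  by apply/eqP; rewrite cards_eq0; apply/eqP/finset.setP => i; rewrite !inE /J andbN.
rewrite -/y (_ : 'X = 1 + y); last by rewrite /y; ring.
rewrite mulr1 => E; apply: (canRL (addrK _)); rewrite addrAC -addrA.
apply: (canLR (addNKr _)); rewrite [RHS]addrC -E; congr (_ + _).
apply: eq_big => [t|t]; first by rewrite okE.
move=> /andP[/forallP ts nts]; rewrite mulrCA -exprS; congr (_ * _ ^+ _).
have {}ts : cell_le (Some t) (Some s) by apply/forallP.
have lts := cell_dim_lt ts nts.
rewrite -subSn // subSS; apply/eqP; rewrite -(eqn_add2l (cell_dim t)) subnKC; last exact: ltnW.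
(* The free directions of [s] split into those free in [t] and those that [t] fixes. *)
rewrite /k /cell_dim -(cardsID [set i | t i == None] [set i | s i == None]).
apply/eqP; congr (_ + _)%N; apply: eq_card => i; rewrite !inE; last by rewrite andbC.
by have /cell_leP/(_ i)[->|->] := ts; rewrite ?andbb ?eqxx.
Qed.

End CubeIntervals.

(** * Cells of a cube avoiding a family of facets *)

Section NewCells.
Variables (I : finType) (A B : {set I * bool}).
Hypothesis Aopp : forall x b, (x, b) \in A -> (x, ~~ b) \in A.
Hypothesis Bopp : forall x b, (x, b) \in B -> (x, ~~ b) \notin A :|: B.

(** The pair [(x, b)] labels the facet where coordinate [x] equals [b]. [A] holds both facets of
    each coordinate in [A'], and [B] exactly one facet of each coordinate in [B']. *)
Let A' := [set x | (x, true) \in A].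
Let B' := [set x | ((x, true) \in B) || ((x, false) \in B)].

Let A'P x b : ((x, b) \in A) = (x \in A').
Proof. by rewrite inE; case: b => //; apply/idP/idP => /Aopp. Qed.

Let cardA' : #|A| = (2 * #|A'|)%N.
Proof.
rewrite mulnC -card_bool -cardsT -cardsX; apply: eq_card => -[x b].
by rewrite finset.in_setX finset.in_setT andbT A'P.
Qed.

Let cardB' : #|B'| = #|B|.
Proof.
have -> : B' = fst @: B.
  apply/finset.setP => x; rewrite inE; apply/orP/imsetP => [[]|[[z b] zB ->]].
  - by exists (x, true).
  - by exists (x, false).
  - by case: b zB => ?; [left|right].
apply: card_in_imset => -[x b] [z c] xB /= zB xz; rewrite -xz in zB *.
have := Bopp xB; rewrite inE negb_or => /andP[_].
by case: b c xB zB => [] [] // _ ->.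
Qed.

Let disjAB x : x \in A' -> x \notin B'.
Proof.
move=> xA; apply/negP; rewrite inE.
by move=> /orP[] /Bopp /=; rewrite inE negb_or A'P xA.
Qed.

Lemma card_type_le j : #|A| = (2 * j)%N -> (#|B| + j <= #|I|)%N.
Proof.
move=> /eqP; rewrite cardA' eqn_pmul2l // => /eqP <-; rewrite -cardB'.
rewrite -cardsUI (_ : B' :&: A' = finset.set0) ?cards0 ?addn0 ?max_card //.
apply/finset.setP => x; rewrite finset.in_setI finset.in_set0; apply/negP => /andP[xB] /disjAB.
by rewrite xB.
Qed.

(** Avoidance is a condition on each coordinate separately: in [A'] it must be free (factor z), in
    [B'] one fixed value remains (z+y), elsewhere both do (z+2y). *)
Lemma sum_new_cells (R : comNzRingType) (y : R) j : #|A| = (2 * j)%N ->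
  \sum_(s : {ffun I -> option bool} | [forall p in A :|: B, s p.1 != Some p.2])
     cube_g y (cell_dim s) * y ^+ (#|I| - cell_dim s)
  = cube_umbra y ('X^j * ('X + y%:P) ^+ #|B| * ('X + (y *+ 2)%:P) ^+ (#|I| - (#|B| + j))).
Proof.
move=> Aj; have Bj := card_type_le Aj.
move: Aj => /eqP; rewrite cardA' eqn_pmul2l // => /eqP Aj.
pose ok x (o : option bool) := if o is Some b then (x, b) \notin A :|: B else true.
have C : #|~: (A' :|: B')| = (#|I| - (#|B| + j))%N.
  rewrite cardsCs finset.setCK cardsU -cardB' Aj (_ : A' :&: B' = finset.set0); last first.
    by apply/finset.setP => x; rewrite finset.in_setI finset.in_set0; apply/negP => /andP[/disjAB/negP].
  by rewrite cards0 subn0 addnC.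
have := sum_cells y ok xpredT; set p := \prod_i _.
have -> : p = 'X^j * ('X + y%:P) ^+ #|B| * ('X + (y *+ 2)%:P) ^+ (#|I| - (#|B| + j)).
  rewrite -C -cardB' -Aj -!prodr_const.
  rewrite big_mkcond [X in _ * X * _]big_mkcond [X in _ * _ * X]big_mkcond -!big_split.
  apply: eq_bigr => x _; rewrite big_option big_mkcond big_bool /= !finset.in_setU !A'P.
  rewrite finset.in_setC finset.in_setU.
  case: (boolP (x \in A')) => [xA|xA] /=.
    by rewrite (negPf (disjAB xA)) !mulr1 !addr0.
  case: (boolP (x \in B')); rewrite inE => xB /=; last first.
    by move: xB; rewrite negb_or => /andP[-> ->] /=; rewrite !mul1r polyCMn mulr2n.
  have := @Bopp x true; have := @Bopp x false; rewrite !finset.in_setU !A'P (negPf xA) /=.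
  move: xB; case: ((x, true) \in B); case: ((x, false) \in B) => //= _.
  - by move=> /(_ isT).
  - by rewrite mulr1 mul1r add0r.
  - by rewrite mulr1 mul1r addr0.
move=> <-; apply: eq_big => [s|s _].
  apply/forall_inP/forallP => [H x|H [x b] /= xS].
    change (ok x (s x)); rewrite /ok; case E : (s x) => [b|] //.
    by apply/negP => /H /=; rewrite E eqxx.
  have : ok x (s x) by exact: H.
  by rewrite /ok; case: (s x) => // c; apply: contra => /eqP[->].
congr (_ * _ ^+ _); rewrite [RHS]cardsCs; congr (_ - _)%N.
by apply: eq_card => x; rewrite !inE negbK.
Qed.

End NewCells.

(** * Faces of polytopes and of the standard cube *)

Section Geometry.
Variables (R : realType) (N : nat).
Implicit Types (P Q G H : set 'rV[R]_N) (x y : 'rV[R]_N).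
Local Open Scope classical_set_scope.

(** The rows of [B] are differences of points of [P], so they lie in the row space of [B']. *)
Lemma has_dim_le P k k' : has_dim P k -> has_dim P k' -> (k <= k')%N.
Proof.
move=> [x0 [B [Px0 /eqP Bfree PB _]]] [x1 [B' [_ _ _ PB']]].
rewrite -Bfree; apply: leq_trans (rank_leq_row B').
apply/mxrankS/row_subP => i.
have -> : row i B = (x0 + row i B - x1) - (x0 - x1).
  by rewrite opprB addrA subrK addrAC subrr add0r.
by apply: addmx_sub; rewrite ?eqmx_opp; apply: PB'.
Qed.

Lemma has_dim_inj P k k' : has_dim P k -> has_dim P k' -> k = k'.
Proof. by move=> Pk Pk'; apply/eqP; rewrite eqn_leq !(has_dim_le (P := P)). Qed.

Lemma dotvD (c x y : 'rV[R]_N) : dotv c (x + y) = dotv c x + dotv c y.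
Proof. by rewrite /dotv -big_split; apply: eq_bigr => i _; rewrite mxE mulrDr. Qed.

Lemma dotvZ a (c x : 'rV[R]_N) : dotv c (a *: x) = a * dotv c x.
Proof. by rewrite /dotv mulr_sumr; apply: eq_bigr => i _; rewrite mxE mulrCA. Qed.

Definition midpoint x y : 'rV[R]_N := 2^-1 *: (x + y).

Lemma polytope_midpoint P x y : polytope P -> P x -> P y -> P (midpoint x y).
Proof.
move=> [s ->] [w [w0 w1 ->]] [v [v0 v1 ->]].
exists (fun i => 2^-1 * (w i + v i)); split=> [i||].
- by rewrite mulr_ge0 ?addr_ge0 // invr_ge0 ler0n.
- by rewrite -mulr_sumr big_split /= w1 v1; field.
- rewrite /midpoint -big_split scaler_sumr; apply: eq_bigr => i _.
  by rewrite /= -scalerDl scalerA.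
Qed.

Lemma face_midpoint P G x y : is_face P G -> P x -> P y -> G (midpoint x y) -> G x /\ G y.
Proof.
move=> [c [b [le ->]]] Px Py [_ /=]; rewrite dotvZ dotvD => E.
have := le _ Px; have := le _ Py; split; split=> //=; lra.
Qed.

Lemma face_sub P G : is_face P G -> G `<=` P.
Proof. by move=> [c [b [_ ->]]]; apply: subIsetl. Qed.

(* Midpoints do not enter a face of P unless both ends are in it, so a point
   of H outside each of the faces can be built one face at a time. *)
Lemma sub_bigcup_faces P H (s : seq (set 'rV[R]_N)) :
  polytope H -> H `<=` P -> H !=set0 -> (forall G, G \in s -> is_face P G) ->
  H `<=` \bigcup_(G in [set` s]) G -> exists2 G, G \in s & H `<=` G.
Proof.
move=> Hpol HP H0 sP Hs; apply: contrapT => /forall2NP Hn.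
have [x Hx xs] : exists2 x, H x & forall G, G \in s -> ~ G x.
  have {}Hn G : G \in s -> ~ H `<=` G by case: (Hn G).
  elim: s {Hs} sP Hn => [|G s IH] sP Hn; first by case: H0 => x Hx; exists x.
  have [||x Hx xs] := IH; try by move=> G' G's; apply: sP || apply: Hn; rewrite inE G's orbT.
  have [p Hp pG] : exists2 p, H p & ~ G p.
    have /existsNP[p /not_implyP[Hp pG]] := Hn G (mem_head _ _).
    by exists p.
  exists (midpoint x p); first exact: polytope_midpoint.
  move=> G'; rewrite inE => /orP[/eqP ->|G's] Gm.
    by have [_ /pG] := face_midpoint (sP G (mem_head _ _)) (HP _ Hx) (HP _ Hp) Gm.
  have /sP G'P : G' \in G :: s by rewrite inE G's orbT.
  by have [/(xs _ G's)] := face_midpoint G'P (HP _ Hx) (HP _ Hp) Gm.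
by have [G /= Gs Gx] := Hs x Hx; apply: xs Gx.
Qed.

End Geometry.

(** * Faces of the standard cube *)

Section StdCube.
Variables (R : realType) (n : nat).
Local Open Scope classical_set_scope.
Implicit Types (a b : cell 'I_n) (c x : 'rV[R]_n).

Definition cell_face a : set 'rV[R]_n :=
  if a is Some s then
    @std_cube R n `&` [set x | forall i, if s i is Some b then x 0 i = b%:R else True]
  else set0.

Lemma cell_face_sub a b : cell_face a `<=` cell_face b <-> cell_le a b.
Proof.
case: a b => [s|] [t|] //=; split=> // H; last 1 first.
- by [].
(* The centre of the cell [s]: its free coordinates 1/2 are neither 0 nor 1, so any cell containing
   it contains [s]. *)
- pose x : 'rV[R]_n := \row_i (if s i is Some b then b%:R else 2^-1).
  have [|_ xt] := H x.
    split=> i /=; rewrite mxE; last by case: (s i).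
    by case: (s i) => [[]|]; rewrite ?lexx ?ler01 //; lra.
  apply/cell_leP => i; have := xt i; rewrite mxE.
  case: (t i) => [b|]; last by left.
  by case: (s i) => [[]|]; case: b => /=; first [by right | by move=> E; exfalso; move: E; lra].
- move=> x [xc xs]; split=> // i; have := xs i.
  by have /cell_leP/(_ i)[->|->] := H.
- exfalso; have [] // := H (\row_i (if s i is Some b then b%:R else 2^-1)).
  split=> i /=; rewrite mxE; last by case: (s i).
  by case: (s i) => [[]|]; rewrite ?lexx ?ler01 //; lra.
Qed.

Definition sign_cell c : {ffun 'I_n -> option bool} :=
  [ffun i => if 0 < c 0 i then Some true else if c 0 i < 0 then Some false else None].

Let cmax c : R := \sum_i Num.max (c 0 i) 0.

Let max_coord (u v : R) : 0 <= v <= 1 -> u * v <= Num.max u 0.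
Proof. by rewrite /Num.max => /andP[v0 v1]; case: (ltP u 0) => u0; nra. Qed.

Let dotv_max c x : @std_cube R n x -> dotv c x <= cmax c.
Proof. by move=> xc; apply: ler_sum => i _; apply/max_coord/xc. Qed.

(** [cmax c] is the maximum of [c] over the cube. It is attained exactly when every coordinate is
    optimal, since the coordinatewise defects are nonnegative and sum to 0. *)
Lemma sign_cell_face c :
  @std_cube R n `&` [set x | dotv c x = cmax c] = cell_face (Some (sign_cell c)).
Proof.
apply/seteqP; split=> x [xc /= H]; split=> //; first move=> i.
  have := @psumr_eq0P R _ xpredT (fun i => Num.max (c 0 i) 0 - c 0 i * x 0 i).
  rewrite sumrB -/(cmax c) -/(dotv c x) H subrr => /(_ _ erefl i isT) E.
  have {}E : Num.max (c 0 i) 0 = c 0 i * x 0 i.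
    by apply/eqP; rewrite -subr_eq0 E // => j _; rewrite subr_ge0 max_coord //; apply: xc.
  rewrite ffunE; have /andP[x0 x1] := xc i.
  move: E; rewrite /Num.max; case: (ltgtP (c 0 i) 0) => //= ci; nra.
apply: eq_bigr => i _; have := H i; rewrite ffunE /Num.max.
by case: (ltgtP (c 0 i) 0) => [ci ->|ci ->|->]; rewrite ?mulr0 ?mulr1 ?mul0r.
Qed.

Lemma std_cube_faceP G : is_face (@std_cube R n) G <-> exists a, G = cell_face a.
Proof.
split=> [[c [b [le ->]]]|[[s|] ->]].
- have [bM|bM] := eqVneq b (cmax c).
    by exists (Some (sign_cell c)); rewrite bM sign_cell_face.
  (* A bound other than the maximum cannot be attained: an attained [b] is at most [cmax c], and the
     vertex with 1 where [c] is positive shows the converse. *)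
  exists None; apply/seteqP; split=> // x [xc /= xb]; case/eqP: bM.
  apply: le_anti; rewrite -{1}xb dotv_max //=.
  have : cell_face (Some (sign_cell c)) (\row_i (if 0 < c 0 i then 1 else 0)).
    split=> i /=; rewrite mxE ?ffunE; first by case: ifP; rewrite lexx ler01.
    by case: ltgtP.
  by rewrite -sign_cell_face => -[vc <-]; apply: le.
- pose c : 'rV[R]_n := \row_i (if s i is Some b then (if b then 1 else -1) else 0).
  exists c, (cmax c); split; first by move=> x; apply: dotv_max.
  rewrite sign_cell_face; congr (cell_face (Some _)); apply/ffunP => i.
  by rewrite ffunE mxE; case: (s i) => [[]|]; rewrite ?ltr01 ?ltr0N1 ?ltrN10 ?ltxx ?ltr10.
- exists 0, 1; split=> [x _|]; first by rewrite /dotv big1 ?ler01 // => i _; rewrite mxE mul0r.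
  apply/seteqP; split=> // x [_ /=]; rewrite /dotv big1 => [/eqP|i _]; last by rewrite mxE mul0r.
  by rewrite eq_sym oner_eq0.
Qed.

End StdCube.

(** * Shelled cubical complexes *)

Section FacetCells.
Variable n : nat.
Implicit Types (p q : 'I_n * bool) (s : {ffun 'I_n -> option bool}).

Definition facet_cell p : {ffun 'I_n -> option bool} :=
  [ffun i => if i == p.1 then Some p.2 else None].

Lemma cell_dim_facet_cell p : (cell_dim (facet_cell p)).+1 = n.
Proof.
have -> : cell_dim (facet_cell p) = #|[set~ p.1]|.
  by apply: eq_card => i; rewrite !inE ffunE; case: (i == p.1).
by rewrite cardsC1 card_ord prednK // (leq_ltn_trans _ (ltn_ord p.1)).
Qed.

Lemma facet_cellP s : (cell_dim s).+1 = n -> exists p, s = facet_cell p.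
Proof.
move=> sk; have : #|~: [set i | s i == None]| = 1%N.
  by rewrite cardsCs finset.setCK card_ord -/(cell_dim s); lia.
move=> /eqP/cards1P[i si].
have [b sib] : exists b, s i = Some b.
  have := finset.set11 i; rewrite -si !inE; case: (s i) => // b; by exists b.
exists (i, b); apply/ffunP => j; rewrite ffunE /=.
case: eqVneq => [->//|ji]; apply/eqP; apply: contraNT ji => sj.
by rewrite -finset.in_set1 -si !inE.
Qed.

Lemma le_facet_cell s p : cell_le (Some s) (Some (facet_cell p)) = (s p.1 == Some p.2).
Proof.
apply/cell_leP/eqP => [/(_ p.1)|sp i]; rewrite ffunE ?eqxx; first by case.
by case: eqVneq => [->|]; [right|left].
Qed.

Lemma facet_cell_inj : injective facet_cell.
Proof.
move=> [x b] [z c] /ffunP/(_ x); rewrite !ffunE /= eqxx.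
by case: eqVneq => // -> [->].
Qed.

End FacetCells.

(** * Face posets of the partial complexes, with n = d - 1 *)

Section Complex.
Variables (R : realType) (N n : nat).
Variables (K : {fset set 'rV[R]_N}) (F : seq (set 'rV[R]_N)).
Hypothesis Kcubical : cubical_complex K.
Hypothesis FK : forall G, G \in F -> G \in K /\ has_dim G n.
Implicit Types (P Q G H : set 'rV[R]_N).
Local Open Scope classical_set_scope.

(** If [H] lies in [P], it is their intersection, hence a face of [P] by the intersection axiom. *)
Lemma complex_face P H : P \in K -> H \in K -> is_face P H <-> H `<=` P.
Proof.
case: Kcubical => -[_ _ _ KI] _ PK HK; split=> [|HP]; first exact: face_sub.
by have [+ _] := KI _ _ PK HK; rewrite setIC (setIidl HP).
Qed.

Lemma mem_complex P H : P \in K -> is_face P H -> H \in K.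
Proof. by case: Kcubical => -[_ _ Kf _] _; apply: Kf. Qed.

Lemma mem_face_poset t H :
  H \in face_poset K F t <-> H \in K /\ exists2 G, G \in take t F & H `<=` G.
Proof.
rewrite !inE /=; split=> [/andP[HK /hasP[G GF /asboolP GH]]|[HK [G GF HG]]].
  by split=> //; exists G => //; apply: face_sub.
rewrite HK; apply/hasP; exists G => //; apply/asboolP/complex_face => //.
by have [] := FK (mem_take GF).
Qed.

(** Labels the faces by cells: [psi] picks preimages of the faces of the standard cube under the
    lattice isomorphism. *)
Lemma comb_cube_cells P m : comb_cube m P ->
  exists psi : cell 'I_m -> set 'rV[R]_N,
    [/\ forall a, is_face P (psi a),
        forall G, is_face P G -> exists a, G = psi a &
        forall a b, psi a `<=` psi b <-> cell_le a b].
Proof.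
move=> [_ [phi [phif phis phile]]].
have /choice[psi psiP] (a : cell 'I_m) :
    exists G, is_face P G /\ phi G = @cell_face R m a.
  have [|G GP E] := phis (@cell_face R m a); last by exists G.
  by apply/std_cube_faceP; exists a.
exists psi; split=> [a|G GP|a b]; first by have [] := psiP a.
  have /std_cube_faceP[a E] := phif _ GP; exists a.
  have [pf pE] := psiP a.
  by apply/seteqP; split; apply/phile; rewrite // E pE.
have [pa aE] := psiP a; have [pb bE] := psiP b.
by rewrite -phile // aE bE; apply: cell_face_sub.
Qed.

Section Interval.
Variables (t m : nat) (H : set 'rV[R]_N) (psi : cell 'I_m -> set 'rV[R]_N).
Hypothesis Ht : H \in face_poset K F t.
Hypothesis psif : forall a, is_face H (psi a).
Hypothesis psis : forall G, is_face H G -> exists a, G = psi a.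
Hypothesis psile : forall a b, psi a `<=` psi b <-> cell_le a b.

Lemma face_cube_interval : cube_interval (face_poset K F t) psi.
Proof.
have /mem_face_poset[HK [G Gt HG]] := Ht; split=> [a|u a uP|a b].
- apply/mem_face_poset; split; first exact: mem_complex (psif a).
  by exists G => //; apply: subset_trans HG; apply: face_sub.
- rewrite subsetEset => ua; apply: psis; have /mem_face_poset[uK _] := uP.
  by apply/complex_face => //; apply: subset_trans ua _; apply: face_sub.
- by apply/idP/idP; rewrite subsetEset => /psile.
Qed.

Lemma psi_top : psi (Some [ffun=> None]) = H.
Proof.
have /mem_face_poset[HK _] := Ht.
have [a Ha] : exists a, H = psi a by apply: psis; apply/complex_face.
apply/seteqP; split; first exact: face_sub.
rewrite {1}Ha; apply/psile; case: (a) => // s.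
by apply/cell_leP => i; left; rewrite ffunE.
Qed.

End Interval.

Lemma cell_dim_top (I : finType) : cell_dim [ffun _ : I => None] = #|I|.
Proof. by rewrite /cell_dim -cardsT; apply: eq_card => i; rewrite !inE ffunE. Qed.

Lemma nonempty_comb_cube G : G \in K -> G !=set0 -> exists m, comb_cube m G.
Proof. by case: Kcubical => _; apply. Qed.

Lemma prank_face t H k :
  H \in face_poset K F t -> has_dim H k -> prank (face_poset K F t) H = k.+1.
Proof.
move=> Ht Hk; have /mem_face_poset[HK _] := Ht.
have [|m Hm] := nonempty_comb_cube HK; first by case: Hk => x [B []]; exists x.
have <- : m = k by apply: has_dim_inj Hk; case: Hm.
have [psi [psif psis psile]] := comb_cube_cells Hm.
rewrite -(psi_top Ht psif psis psile).
by rewrite (prank_cell (face_cube_interval Ht psif psis psile)) cell_dim_top card_ord.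
Qed.

Lemma mem_facet_poset t G : G \in take t F -> G \in face_poset K F t.
Proof.
by move=> Gt; apply/mem_face_poset; have [] := FK (mem_take Gt); split=> //; exists G.
Qed.

Lemma facet_comb_cube G : G \in F -> comb_cube n G.
Proof.
move=> /FK[GK Gn]; have [|m Gm] := nonempty_comb_cube GK.
  by case: Gn => x [B []]; exists x.
by have -> : n = m by apply: has_dim_inj Gn _; case: Gm.
Qed.

(** Every face lies in an n-cube of the list, of rank n + 1. That the height is independent of [t]
    is what [toric_f_lower] requires. *)
Lemma height_face_poset t : (0 < t)%N -> (0 < size F)%N ->
  height (face_poset K F t) = n.+1.
Proof.
move=> t0 F0; apply/eqP; rewrite eqn_leq; apply/andP; split.
  apply: height_le_prank => H /mem_face_poset[HK [G Gt HG]].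
  have Gf := facet_comb_cube (mem_take Gt).
  have [psi [psif psis psile]] := comb_cube_cells Gf.
  have psiP := face_cube_interval (mem_facet_poset Gt) psif psis psile.
  have [GK _] := FK (mem_take Gt).
  have [[s|] ->] : exists a, H = psi a by apply: psis; apply/complex_face.
    by rewrite (prank_cell psiP) ltnS -[leqRHS](card_ord n) max_card.
  by rewrite (prank_empty_cell psiP).
have Gt : nth set0 F 0 \in take t F by case: (F) (t) F0 t0 => [|G F'] [|t'] //= _ _; rewrite mem_head.
have [_ Gn] := FK (mem_take Gt).
by rewrite -(prank_face (mem_facet_poset Gt) Gn) prank_le_height // mem_facet_poset.
Qed.

Section Facet.
Variables (t : nat) (P : set 'rV[R]_N) (psi : cell 'I_n -> set 'rV[R]_N).
Hypothesis Pt : P \in take t F.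
Hypothesis psif : forall a, is_face P (psi a).
Hypothesis psis : forall G, is_face P G -> exists a, G = psi a.
Hypothesis psile : forall a b, psi a `<=` psi b <-> cell_le a b.

Let PK : P \in K. Proof. by have [] := FK (mem_take Pt). Qed.
Let psiK a : psi a \in K. Proof. exact: mem_complex (psif a). Qed.
Let psiP := face_cube_interval (mem_facet_poset Pt) psif psis psile.

Lemma psi_empty : psi None = set0.
Proof.
have K0 : set0 \in K by case: Kcubical => -[].
have [a E] : exists a, set0 = psi a by apply: psis; apply/complex_face.
by apply/seteqP; split=> //; rewrite E; apply/psile.
Qed.

Lemma psi_nonempty s : psi (Some s) !=set0.
Proof. by apply/set0P/eqP; rewrite -psi_empty => /(cube_interval_inj psiP). Qed.

(** The lattice isomorphism of [P] carries no affine information on its faces. But the face is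
    itself a cube of some dimension [m], and its rank computed in two ways gives
    [m = cell_dim s]. *)
Lemma has_dim_psi s : has_dim (psi (Some s)) (cell_dim s).
Proof.
have [m [mdim _]] := nonempty_comb_cube (psiK (Some s)) (psi_nonempty s).
have := prank_face (cube_interval_mem psiP (Some s)) mdim.
by rewrite (prank_cell psiP) => -[->].
Qed.

Lemma ridge_psi G : ridge n.+1 P G <-> exists p, G = psi (Some (facet_cell p)).
Proof.
split=> [[/psis[[s|] ->] [k [kn]] kd]|[p ->]].
- have sk : (cell_dim s).+1 = n by rewrite (has_dim_inj (has_dim_psi s) kd).
  by have [p ->] := facet_cellP sk; exists p.
- by case: kd => x [B []]; rewrite psi_empty.
- split; first exact: psif.
  by exists (cell_dim (facet_cell p)); [rewrite cell_dim_facet_cell | exact: has_dim_psi].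
Qed.

Lemma opposite_psi p q :
  opposite n.+1 P (psi (Some (facet_cell p))) (psi (Some (facet_cell q))) <->
  q = (p.1, ~~ p.2).
Proof.
split=> [[_ _ pq]|->].
  have [//|ne] := eqVneq q (p.1, ~~ p.2); exfalso.
  (* A cell common to both facets; if they share the coordinate, then [q] not being opposite to [p]
     forces equal values. *)
  pose s : {ffun 'I_n -> option bool} :=
    [ffun i => if i == p.1 then Some p.2 else if i == q.1 then Some q.2 else None].
  have [x xs] := psi_nonempty s.
  suff : (set0 : set 'rV[R]_N) x by [].
  rewrite -pq; split; apply: (proj2 (psile _ _)) xs; rewrite le_facet_cell ffunE ?eqxx //.
  case: (eqVneq q.1 p.1) => // qp; apply/eqP; congr Some; apply/eqP; apply: contraNT ne => pq2.
  rewrite -pair_eqE /= qp eqxx /=; by case: (q.2) (p.2) pq2 => [] [].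
split; try by apply/ridge_psi; eexists.
have KI : psi (Some (facet_cell p)) `&` psi (Some (facet_cell (p.1, ~~ p.2))) \in K.
  case: Kcubical => -[_ _ _ KI] _.
  by have [/(mem_complex (psiK _))] := KI _ _ (psiK (Some (facet_cell p))) (psiK (Some (facet_cell (p.1, ~~ p.2)))).
have [[s|] E] : exists a, psi (Some (facet_cell p)) `&` psi (Some (facet_cell (p.1, ~~ p.2))) = psi a.
- by apply: psis; apply/complex_face => // x [/(face_sub (psif _))].
- have : psi (Some s) `<=` psi (Some (facet_cell p)) by rewrite -E; apply: subIsetl.
  have : psi (Some s) `<=` psi (Some (facet_cell (p.1, ~~ p.2))) by rewrite -E; apply: subIsetr.
  move=> /psile + /psile; rewrite !le_facet_cell /= => /eqP -> /eqP[].
  by case: (p.2).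
- by rewrite E psi_empty.
Qed.

Lemma card_facet_labels (A : {fset set 'rV[R]_N}) :
  (forall G, G \in A -> exists p, G = psi (Some (facet_cell p))) ->
  #|[set p | psi (Some (facet_cell p)) \in A]%SET| = #|` A|.
Proof.
move=> AP; rewrite cardE -(size_map (fun p => psi (Some (facet_cell p)))).
apply: perm_size; apply: uniq_perm; rewrite ?fset_uniq //.
  rewrite map_inj_uniq ?enum_uniq // => p q.
  by move=> /(cube_interval_inj psiP) [] /facet_cell_inj.
move=> G; apply/mapP/idP => [[p]|GA]; first by rewrite mem_enum inE => pA ->.
by have [p E] := AP G GA; exists p; rewrite // mem_enum inE -E.
Qed.

End Facet.

Let y : {poly int} := 'X - 1.

(** With no facets to avoid, all nonempty cells sum to L((z+2y)^n); the empty face adds the missing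
    y^(n+1). *)
Lemma toric_f_first_facet : (0 < size F)%N ->
  toric_f (face_poset K F 1) = cube_contrib y n 0 0.
Proof.
move=> F0; have [P P1] : exists P, take 1 F = [:: P].
  by case: (F) F0 => // P s _; exists P; rewrite /= take0.
have Pt : P \in take 1 F by rewrite P1 mem_head.
have [psi [psif psis psile]] := comb_cube_cells (facet_comb_cube (mem_take Pt)).
have psiP := face_cube_interval (mem_facet_poset Pt) psif psis psile.
have Q0 : face_poset K F 1 != fset0 by apply/fset0Pn; exists P; apply: mem_facet_poset.
rewrite /toric_f (negPf Q0) height_face_poset //.
rewrite (sum_cube_interval psiP (p := xpredT)) => [|u /mem_face_poset[uK [G + uG]] _|a _]; last 2 first.
- rewrite P1 inE => /eqP GP; rewrite {}GP in uG.
  have [a ->] : exists a, u = psi a.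
    by apply: psis; apply/complex_face => //; have [] := FK (mem_take Pt).
  by exists a.
- by rewrite (cube_interval_mem psiP).
rewrite big_option /= (prank_empty_cell psiP) subn0.
have -> : below (face_poset K F 1) (psi None) = fset0.
  apply/eqP; rewrite -fsubset0; apply/fsubsetP => u; rewrite mem_below => /andP[uP].
  by move=> /(cube_interval_below psiP uP)[[s|] _] //=; rewrite eqxx.
rewrite toric_gE eqxx mul1r -/y.
have := @sum_new_cells 'I_n finset.set0 finset.set0 _ _ _ y 0.
rewrite !cards0 finset.setU0 subn0 expr0 expr0 !mul1r card_ord => H.
apply: (canLR (addNKr _)); rewrite addrC -cube_umbra_binomial -H //; last 2 first.
- by move=> x b; rewrite finset.in_set0.
- by move=> x b; rewrite finset.in_set0.
apply: eq_big => [s|s _].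
  by apply/esym/forall_inP => p; rewrite finset.in_set0.
by rewrite (toric_g_below_cell psiP) (prank_cell psiP) subSS.
Qed.

Lemma toric_f_attach t i j : (2 <= t <= size F)%N -> has_type n.+1 F t i j ->
  (i + j <= n)%N /\
  toric_f (face_poset K F t) - toric_f (face_poset K F t.-1) =
  cube_umbra y ('X^j * ('X + y%:P) ^+ i * ('X + (y *+ 2)%:P) ^+ (n - (i + j))).
Proof.
case: t => // t /andP[t1 tF] [[A [B [[cA cB] Aopp Bopp IE]]] _].
move: IE Aopp Bopp; rewrite [t.+1.-1]/=; set P := nth set0 F t; set I := attaching_set _ _.
move=> IE Aopp Bopp; have F0 : (0 < size F)%N by apply: leq_trans tF.
have takeE : take t.+1 F = rcons (take t F) P by rewrite (take_nth set0).
have Pt : P \in take t.+1 F by rewrite takeE mem_rcons mem_head.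
have [PK _] := FK (mem_take Pt).
have [psi [psif psis psile]] := comb_cube_cells (facet_comb_cube (mem_take Pt)).
have psiP := face_cube_interval (mem_facet_poset Pt) psif psis psile.
have ridgeP := ridge_psi Pt psif psis psile.
have oppP := opposite_psi Pt psif psis psile.
have psiK a : psi a \in K by apply: mem_complex (psif a).
have Ppsi u : u \in K -> u `<=` P -> exists a, u = psi a.
  by move=> uK uP; apply: psis; apply/complex_face.
pose facetp p := psi (Some (facet_cell p)).
have Ar G : G \in A -> exists p, G = facetp p.
  by move=> /Aopp[G' _ [/ridgeP]].
have Br G : G \in B -> exists p, G = facetp p by move=> /Bopp[/ridgeP].
pose SA := [set p | facetp p \in A]%SET; pose SB := [set p | facetp p \in B]%SET.
have sI p : p \in (SA :|: SB)%SET -> facetp p `<=` I.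
  by rewrite !inE IE => /orP[pA|pB] x px; [left|right]; exists (facetp p).
have SAopp x b : (x, b) \in SA -> (x, ~~ b) \in SA.
  rewrite !inE => /Aopp[G' G'A GG']; have [q qE] := Ar G' G'A.
  by move: GG'; rewrite qE => /oppP <-; rewrite -qE.
have SBopp x b : (x, b) \in SB -> (x, ~~ b) \notin (SA :|: SB)%SET.
  rewrite inE => /Bopp[_ H]; apply/negP => /sI; apply: H.
  by apply/oppP.
have cSA : #|SA| = (2 * j)%N by rewrite (card_facet_labels Pt psif psis psile Ar).
have cSB : #|SB| = i by rewrite (card_facet_labels Pt psif psis psile Br).
have := card_type_le SAopp SBopp cSA; rewrite cSB card_ord => ijn; split=> //.
have QP H : H \in face_poset K F t -> H \in face_poset K F t.+1.
  move=> /mem_face_poset[HK [G Gt HG]]; apply/mem_face_poset; split=> //.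
  by exists G; rewrite // takeE mem_rcons inE Gt orbT.
have F0t : nth set0 F 0 \in take t F.
  by case: (F) (t) F0 t1 => [|G F'] [|t'] //= _ _; rewrite mem_head.
(* A nonempty cell is old iff it lies in a listed facet. Forward: it is covered by the listed
   facets, so [sub_bigcup_faces] puts it in one of them. *)
have oldP s : psi (Some s) \in face_poset K F t <->
    exists2 p, p \in (SA :|: SB)%SET & s p.1 = Some p.2.
  split=> [/mem_face_poset[sK [G Gt sG]]|[p pS sp]].
    have [|||||H] := @sub_bigcup_faces _ _ P (psi (Some s)) (enum_fset A ++ enum_fset B).
    - by case: Kcubical => -[_ Kpol _ _] _; apply: Kpol; apply: psiK.
    - exact: face_sub (psif _).
    - exact: psi_nonempty Pt psif psis psile s.
    - by move=> G'; rewrite mem_cat => /orP[/Ar|/Br] [p ->]; apply: psif.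
    - move=> x sx; have : I x.
        by split; [exact: face_sub sx | exists G => //; apply: sG].
      by rewrite IE => -[] [G' G'A G'x]; exists G' => //=; rewrite mem_cat; apply/orP; [left|right].
    rewrite mem_cat => HAB sH.
    have [p HE] : exists p, H = facetp p by case/orP: HAB => [/Ar|/Br].
    exists p; first by rewrite !inE -HE.
    by apply/eqP; rewrite -le_facet_cell; apply/psile; rewrite -/(facetp p) -HE.
  (* Backward: a listed facet is covered by the faces in which [P] meets earlier members of [F],
     hence lies in a single earlier member. *)
  have [|||||H] := @sub_bigcup_faces _ _ P (facetp p) [seq P `&` G | G <- take t F].
  - by case: Kcubical => -[_ Kpol _ _] _; apply: Kpol; apply: psiK.
  - exact: face_sub (psif _).
  - exact: psi_nonempty Pt psif psis psile _.
  - move=> G' /mapP[G Gt ->]; case: Kcubical => -[_ _ _ KI] _.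
    by have [GK _] := FK (mem_take Gt); have [] := KI _ _ PK GK.
  - move=> x /(sI p pS)[Px [G Gt Gx]]; exists (P `&` G) => //=.
    by apply/mapP; exists G.
  move=> /mapP[G Gt ->] pG; apply/mem_face_poset; split=> //; exists G => //.
  apply: subset_trans (subset_trans pG (@subIsetr _ _ _)).
  by apply/psile; rewrite le_facet_cell sp.
rewrite toric_f_lower ?height_face_poset //; last 3 first.
- by apply/fsubsetP => H; apply: QP.
- move=> u v /mem_face_poset[uK _] /mem_face_poset[_ [G Gt vG]]; rewrite subsetEset => uv.
  by apply/mem_face_poset; split=> //; exists G => //; apply: subset_trans vG.
- by apply/fset0Pn; exists (nth set0 F 0); apply: mem_facet_poset.
(* The empty face is already present before step [t.+1], so the predicate is false at [None]. *)
rewrite (sum_cube_interval psiP (p := fun a : cell 'I_n => if a is Some s then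
    [forall p in (SA :|: SB)%SET, s p.1 != Some p.2] else false)); last 2 first.
- move=> u uP uQ; have /mem_face_poset[uK [G Gt uG]] := uP.
  have GP : G = P.
    move: Gt; rewrite takeE mem_rcons inE => /orP[/eqP //|Gt].
    by case/negP: uQ; apply/mem_face_poset; split=> //; exists G.
  rewrite GP in uG; have [[s|] E] := Ppsi u uK uG.
    exists (Some s) => //; apply/forall_inP => p pS; apply/negP => /eqP sp.
    by case/negP: uQ; rewrite E; apply/oldP; exists p.
  case/negP: uQ; rewrite E; apply/mem_face_poset; split=> //.
  by exists (nth set0 F 0); rewrite // (psi_empty Pt psis psile).
- case=> // s /forall_inP sS; rewrite (cube_interval_mem psiP).
  by apply/negP => /oldP[p /sS /negP pS sp]; apply: pS; apply/eqP.
rewrite big_option /= add0r -cSB -[X in cube_umbra _ (_ * _ ^+ (X - _))](card_ord n).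
rewrite -(sum_new_cells SAopp SBopp y cSA); apply: eq_bigr => s _.
by rewrite (toric_g_below_cell psiP) (prank_cell psiP) subSS card_ord.
Qed.

End Complex.

(** * Contributions along a shelling *)

(** [K] contains the empty face, and a member with the most members below it is maximal, hence a
    facet. *)
Lemma shelling_nonempty (R : realType) (N d : nat) (K : {fset set 'rV[R]_N})
    (F : seq (set 'rV[R]_N)) : cubical_complex K -> shelling d K F -> (0 < size F)%N.
Proof.
move=> [[K0 _ _ _] _] [_ FP _].
have [G GK Gmax] : exists2 G, G \in K & forall H, H \in K -> (G <= H)%O -> H = G.
  have K0' : (#|` K| > 0)%N by rewrite cardfs_gt0; apply/fset0Pn; exists set0.
  case: (@arg_maxnP K [` K0]%fset xpredT (fun G => #|` [fset H in K | (H <= val G)%O]%fset|) isT) => G _ Gmax.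
  exists (val G); first exact: valP.
  move=> H HK GH; have := Gmax [` HK]%fset isT; rewrite /= leqNgt => le.
  apply/eqP; apply: contraNT le => HG; apply: fproper_ltn_card; rewrite fproperE; apply/andP; split.
    by apply/fsubsetP => v; rewrite !inE => /andP[-> /le_trans ->].
  apply/fsubsetPn; exists H; rewrite !inE HK ?lexx //=.
  by apply: contra HG => HG; rewrite eq_le HG GH.
suff : G \in F by case: (F).
by apply/FP; split=> // Q QK GQ; apply: Gmax => //; rewrite subsetEset.
Qed.

Theorem theorem2p1 (R : realType) (N d : nat)
    (K : {fset set 'rV[R]_N}) (F : seq (set 'rV[R]_N))
    (d_ge1 : (1 <= d)%N)
    (K_cubical : cubical_complex K)
    (K_pure : pure_of_dim K d.-1)
    (F_shelling : shelling d K F) :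
  toric_f (face_poset K F 1) = toric_contrib d 0 0 /\
  forall t i j : nat,
    (2 <= t <= size F)%N ->
    has_type d F t i j ->
    (j <> d.-1 ->
       toric_f (face_poset K F t) - toric_f (face_poset K F t.-1)
       = toric_contrib d i j) /\
    (i = 0%N -> j = d.-1 ->
       toric_f (face_poset K F t) - toric_f (face_poset K F t.-1)
       = toric_contrib_closed d).
Proof.
have F0 := shelling_nonempty K_cubical F_shelling.
have FK G : G \in F -> G \in K /\ has_dim G d.-1.
  by case: F_shelling => _ FP _ /FP fG; split; [case: fG | apply: K_pure].
case: d d_ge1 K_pure F_shelling FK => // n _ _ _ FK /=; rewrite toric_contribE.
split=> [|t i j tF ty]; first exact: toric_f_first_facet.
have [ijn ->] := toric_f_attach K_cubical FK tF ty.
(* If [j] is not n, the type forces [i] positive and [cube_umbra_shape] applies; for type (0, n)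
   only z^n is left, with value [cube_g]. *)
have [_ [_ i0]] := ty; split=> [jn|-> ->].
  case: i i0 ijn {ty} => [/(_ erefl)//|i _ ijn].
  by rewrite cube_umbra_shape subnKC // toric_contribE.
by rewrite toric_contrib_closedE add0n subnn !mulr1 cube_umbraXn.
Qed.
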